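(* Let $n\ge 1$ and $d\ge 2$ be integers with $2d\le n(d-1)$, and let $f\in\Sigma_{n,2d}$ be a strictly positive polynomial lying in the boundary of $\Sigma_{n,2d}$. Assume that $\mathrm{EGH}(n,d)$ is true. Then any decomposition $f=p_1^2+\dots+p_s^2$ with $p_1,\dots,p_s\in H_{n,d}$ linearly independent satisfies $s\le N(n,d,2d)-1$.
   Context: $H_{n,d}$ denotes the real vector space of homogeneous polynomials of degree $d$ in $n$ variables with coefficients in $\mathbb{R}$. $\Sigma_{n,2d}\subset H_{n,2d}$ is the convex cone of finite sums of squares of polynomials in $H_{n,d}$; its boundary is taken in $H_{n,2d}$. A polynomial $f\in H_{n,2d}$ is strictly positive if $f(x)>0$ for all $x\in\mathbb{R}^n\setminus\{0\}$. For $d\ge2$ and $d\le k\le n(d-1)$ write $k=q(d-1)+r$ with $0\le r<d-1$. Let $C(n,d,k)$ be the number of monomials of degree $d$ dividing $m(n,d,k)=x_1^{d-1}\cdots x_q^{d-1}x_{q+1}^r$ (if $r=0$ the last factor is ignored); equivalently $C(n,d,k)=\binom{q+d}{d}-\binom{q+d-r-1}{q}-q$. Set $N(n,d,k)=\binom{n+d-1}{d}-C(n,d,k)+1$. A sequence of parameters in degree $d$ is a sequence $p_1,\dots,p_n$ of $n$ homogeneous polynomials of degree $d$ in $n$ variables with $\sqrt{\langle p_1,\dots,p_n\rangle}=\langle x_1,\dots,x_n\rangle$. The Hilbert function of a homogeneous ideal $I\subset\mathbb{R}[x_1,\dots,x_n]$ is $\mathrm{HF}_k(I)=\dim_{\mathbb{R}}(\mathbb{R}[x_1,\dots,x_n]/I)_k$.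 ''$\mathrm{EGH}(n,d)$ is true'' means: for every homogeneous ideal $I\subset\mathbb{R}[x_1,\dots,x_n]$ generated by polynomials in $H_{n,d}$ and containing a sequence of parameters in degree $d$, there exists a homogeneous ideal $J$ containing $\{x_1^d,\dots,x_n^d\}$ with the same Hilbert function as $I$. *)

(* Defs.v *)
From HB Require Import structures.
From mathcomp Require Import all_boot all_order all_algebra.
From mathcomp Require Import boolp classical_sets reals topology.
From mathcomp Require Import mpoly.

Set Implicit Arguments.
Unset Strict Implicit.
Unset Printing Implicit Defensive.

Import Order.TTheory GRing.Theory Num.Theory.
Import numFieldTopology.Exports.

Local Open Scope classical_set_scope.
Local Open Scope ring_scope.

(* The Euclidean topology of a finite-dimensional real vector space, pulled
   back from 'rV[R]_N along the coordinates in a basis; all bases give the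
   same topology. *)
Definition euclidean (R : realType) (V : vectType R) : topologicalType :=
  initial_topology
    (fun v : V => \row_(i < \dim {:V}) coord (vbasis {:V}) i v).

Definition boundary (T : topologicalType) (A : set T) : set T :=
  closure A `\` interior A.

(* The space H_{n,d} is [dhomog n R d]; the library gives it its structure of
   finite-dimensional vector space when the number of variables has the form
   [n.+1]. *)
Definition sos_cone (R : realType) (n d : nat) : set (dhomog n R (2 * d)) :=
  [set f : dhomog n R (2 * d) | exists ps : seq (dhomog n R d),
    (f : {mpoly R[n]}) = \sum_(p <- ps) (p : {mpoly R[n]}) ^+ 2].

Definition strictly_positive (R : realType) (n : nat) (f : {mpoly R[n]}) :=
  forall x : 'I_n -> R, (exists i, x i != 0) -> 0 < f.@[x].

(* Ideals need not be proper. *)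
Definition is_ideal (A : comNzRingType) (I : set A) : Prop :=
  [/\ I 0, forall x y, I x -> I y -> I (x + y) & forall a x, I x -> I (a * x)].

Definition ideal_gen (A : comNzRingType) (G : set A) : set A :=
  smallest (@is_ideal A) G.

Definition radical (A : comNzRingType) (I : set A) : set A :=
  [set x | exists m : nat, I (x ^+ m)].

Definition is_homog_ideal (R : realType) (n : nat) (I : set {mpoly R[n]}) :=
  is_ideal I /\ forall p k, I p -> I (pihomog mdeg k p).

(* The piece of degree k of an ideal; see [graded_partP]. *)
Definition graded_part (R : realType) (n : nat) (I : set {mpoly R[n.+1]})
    (k : nat) : {vspace dhomog n.+1 R k} :=
  xget 0%VS [set W | forall p : dhomog n.+1 R k, p \in W <-> I p].

Lemma graded_partP (R : realType) (n : nat) (I : set {mpoly R[n.+1]}) (k : nat) :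
  is_ideal I -> forall p : dhomog n.+1 R k, p \in graded_part I k <-> I p.
Proof.
move=> [I0 ID IM].
suff /(xgetPex 0%VS) : exists W : {vspace dhomog n.+1 R k},
  forall p : dhomog n.+1 R k, p \in W <-> I p by [].
pose V := dhomog n.+1 R k.
pose P m := `[< exists2 W : {vspace V}, forall p : V, p \in W -> I p & \dim W = m >].
have exP : exists m, P m.
  exists 0; apply/asboolP; exists 0%VS; last by rewrite dimv0.
  by move=> p; rewrite memv0 => /eqP ->.
have ubP m : P m -> (m <= \dim {:V})%N.
  by move=> /asboolP [W _ <-]; apply/dimvS/subvf.
case: (ex_maxnP exP ubP) => m /asboolP [W WI dW] maxm.
exists W => p; split; first exact: WI.
move=> Ip; apply/negPn/negP => pW.
have : P (\dim (W + <[p]>)%VS).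
  apply/asboolP; exists (W + <[p]>)%VS => // q /memv_addP [u uW [v /vlineP [c ->] ->]].
  by apply: ID; [exact: WI|rewrite linearZ /= -mul_mpolyC; exact: IM].
move=> /maxm; rewrite -dW => le_dim.
have : (W == W + <[p]>)%VS by rewrite eqEdim addvSl.
move=> /eqP eW; move: pW; rewrite eW.
by rewrite memvE addvSr.
Qed.

(* For homogeneous I, the piece of degree k of the quotient by I is the
   quotient of H_{n,k} by the piece of degree k of I. *)
Definition HF (R : realType) (n : nat) (I : set {mpoly R[n.+1]}) (k : nat) : nat :=
  (\dim {:dhomog n.+1 R k} - \dim (graded_part I k))%N.

Definition seq_of_parameters (R : realType) (n d : nat)
    (p : 'I_n -> {mpoly R[n]}) : Prop :=
  (forall i, p i \is d.-homog) /\
  radical (ideal_gen (range p)) = ideal_gen (range (fun i : 'I_n => 'X_i)).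

(* As the number of variables is [n.+1], [EGH R n d] is EGH(n + 1, d). *)
Definition EGH (R : realType) (n d : nat) : Prop :=
  forall I : set {mpoly R[n.+1]},
    is_homog_ideal I ->
    (exists2 G : set {mpoly R[n.+1]},
       G `<=` [set p | p \is d.-homog] & I = ideal_gen G) ->
    (exists2 p, seq_of_parameters d p & range p `<=` I) ->
    exists J : set {mpoly R[n.+1]},
      [/\ is_homog_ideal J,
          forall i : 'I_n.+1, J ('X_i ^+ d)
        & forall k, HF J k = HF I k].

(* Exponents are indexed from 0, so those of x_1, ..., x_q are at i < q. *)
Definition mndk (n d k : nat) : 'X_{1..n} :=
  let q := (k %/ d.-1)%N in let r := (k %% d.-1)%N in
  [multinom (if (i < q)%N then d.-1 else if i == q :> nat then r else 0%N) | i < n].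

Definition Cndk (n d k : nat) : nat :=
  #|[pred m : 'X_{1..n < d.+1} | (mdeg m == d) && (m <= mndk n d k)%MM]|.

Definition Nndk (n d k : nat) : nat := ('C(n + d - 1, d) - Cndk n d k + 1)%N.

(* Main.v *)
Require Import Defs.
From HB Require Import structures.
From mathcomp Require Import all_boot all_order all_algebra.
From mathcomp Require Import boolp classical_sets reals topology.
From mathcomp Require Import mpoly.
From mathcomp Require Import lra zify.

(** Since [f] lies on the boundary of the cone of sums of squares, some nonzero
    linear functional [L] on forms of degree 2d is nonnegative on squares and
    vanishes at [f] ([supporting_functional]).  Let W be the kernel of the
    quadratic form p |-> L(p^2).  In any decomposition of [f] into squares, each
    L(p_i^2) is zero, hence each p_i lies in W ([squares_in_kernel]), so that s
    is at most dim W.  The point is to bound dim W.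

    Choose [L] with W of maximal dimension.  Then [L] spans an extreme ray: any
    functional that kills the products of W with all forms of degree d is a
    multiple of [L].  Otherwise let L - t M be the last positive semidefinite
    functional on the half-line from [L] in the direction - M.  If its kernel were
    W again, its quadratic form would dominate that of M ([psd_dominates]) and t
    could be increased; so the kernel is larger than W, against the choice of [L]
    ([extremal_functional]).  In terms of the ideal I generated by W, this says that
    I_d = W and that I_2d is exactly the hyperplane L = 0.

    The ideal I contains a power of every variable
    ([extremal_apolar_nilpotent]).  Modulo I, all forms of degree 2d are multiples
    of a single term u with L(u) = 1.  Write u = x_j v and let lam be the real
    point with coordinates L(x_i v).  Then x_i u is congruent to lam_i x_j u,
    whence P u is congruent to P(lam) x_j^(2d) u for every form P of degree 2d.
    For P = f the left side lies in I because L(f) = 0, and f(lam) > 0, so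
    x_j^(2d) u lies in I.  Then so does P u for every P, and in particular the
    powers x_i^(4d) do.  Strict positivity of [f] enters here: it says that [L] is
    not an evaluation at a real point.

    An ideal that is generated in degree d and contains powers of the variables
    contains a sequence of parameters in degree d: as long as there are more
    generators than variables, they satisfy a homogeneous algebraic relation, and
    after a linear change of generators this relation shows that one of them is
    in the radical of the ideal of the others ([eliminate_generator],
    [few_generators]).  Hence EGH applies to I and yields an ideal J containing
    the x_i^d with the same Hilbert function.

    As J is proper in degree 2d, some monomial m of degree 2d is not a leading
    monomial of J.  Its exponents are below d, and none of its divisors of degree
    d is a leading monomial, so that dim W = dim J_d is at most the number of
    monomials of degree d minus the number of divisors of m of degree d
    ([escaping_monomial]).  That number of divisors is the coefficient of t^d in
    the product of the polynomials 1 + t + ... + t^(m_i), and such products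
    decrease coefficientwise when the exponents are made as unequal as the bound
    d - 1 allows, which leads to m(n,d,2d) ([Cndk_min]). *)

Set Implicit Arguments.
Unset Strict Implicit.
Unset Printing Implicit Defensive.

Import Order.TTheory GRing.Theory Num.Theory.
Import numFieldTopology.Exports.
Local Open Scope classical_set_scope.
Local Open Scope ring_scope.

(** * Separating functionals in finite dimension *)

Lemma separating_functional (F : fieldType) (V : vectType F) (U : {vspace V})
    (v : V) : v \notin U ->
  exists2 l : 'Hom(V, F^o), forall u, u \in U -> l u = 0 & l v = 1.
Proof.
move=> vU; pose x := v - projv U v.
have x0 : x != 0.
  by apply: contraNneq vU => /eqP; rewrite subr_eq0 => /eqP ->; exact: memv_proj.
have [i xi] : exists i, coord (vbasis {:V}) i x != 0.
  apply/existsP; apply: contraNT x0; rewrite negb_exists => /forallP xi.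
  rewrite (coord_vbasis (memvf x)) big1 // => i _.
  by have /negbNE/eqP -> := xi i; rewrite scale0r.
pose c : {linear V -> F^o} := coord (vbasis {:V}) i.
exists ((coord (vbasis {:V}) i x)^-1 *: (linfun c \o (\1 - projv U)))%VF.
  move=> u uU; rewrite scale_lfunE comp_lfunE lfunE /= add_lfunE opp_lfunE id_lfunE.
  by rewrite projv_id // subrr linear0 scaler0.
rewrite scale_lfunE comp_lfunE lfunE /= add_lfunE opp_lfunE id_lfunE.
by rewrite [LHS]mulVf.
Qed.

Definition is_cone (R : numDomainType) (V : lmodType R) (C : set V) : Prop :=
  [/\ C 0, forall x y, C x -> C y -> C (x + y)
    & forall a x, 0 <= a -> C x -> C (a *: x)].

Definition order_unit (R : numDomainType) (V : lmodType R) (C : set V) (e : V) :=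
  forall v, exists2 a, 0 <= a & C (a *: e + v).

(** The M. Riesz extension argument: a functional with value 1 at [e] that is
    nonnegative on the part of the cone in a subspace extends to one more
    dimension, because the order unit makes the two constraints on the new value
    an upper and a lower bound; a subspace of maximal dimension is everything. *)
Lemma positive_functional (R : realType) (V : vectType R) (C : set V) (e : V) :
  is_cone C -> order_unit C e -> ~ C (- e) ->
  exists2 l : 'Hom(V, R^o), l e = 1 & forall x, C x -> 0 <= l x.
Proof.
move=> [C0 CD CZ] eu Ce.
pose P (m : nat) := `[< exists2 U : {vspace V}, \dim U = m & e \in U /\
  exists2 l : 'Hom(V, R^o), l e = 1 & forall x, x \in U -> C x -> 0 <= l x >].
have e0 : e != 0.
  by apply/eqP => e0; apply: Ce; rewrite e0 oppr0.
have exP : exists m, P m.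
  exists (\dim <[e]>); apply/asboolP; exists <[e]>%VS => //.
  split; first exact: memv_line.
  have [|l _ le] := @separating_functional _ V 0%VS e; first by rewrite memv0.
  exists l => // x /vlineP [a ->{x}] Ca; rewrite linearZ /= le.
  rewrite [leRHS]mulr1 leNgt; apply/negP => a0; apply: Ce.
  have -> : - e = (- a)^-1 *: (a *: e).
    by rewrite scalerA invrN mulNr mulVf ?scaleN1r // lt_eqF.
  by apply: CZ => //; rewrite invr_ge0 oppr_ge0 ltW.
have ubP m : P m -> (m <= \dim {:V})%N.
  by move=> /asboolP [U <- _]; apply/dimvS/subvf.
case: (ex_maxnP exP ubP) => m /asboolP [U dU [eU [l le lC]]] maxm.
have [UT|/subvPn[v _ vU]] := boolP ({:V} <= U)%VS.
  exists l => // x; apply: lC; exact: subvP UT x (memvf x).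
have [p pU pv] := separating_functional vU.
(* The value of the extension at v has to lie between the values of l at the
   elements of U below v and at those above v. *)
have [s [sup_ub sup_lub]] : exists s : R,
    (forall x, x \in U -> C (v - x) -> l x <= s) /\
    (forall y, y \in U -> C (y - v) -> s <= l y).
  pose A : set R := [set l x | x in [set x | x \in U /\ C (v - x)]].
  have AB x y : x \in U -> C (v - x) -> y \in U -> C (y - v) -> l x <= l y.
    move=> xU Cx yU Cy; have : 0 <= l (y - x).
      apply: lC; first by rewrite memvB.
      by have := CD _ _ Cy Cx; rewrite addrA subrK.
    by rewrite linearB subr_ge0.
  have [a _ Ca] := eu v.
  have [b _ Cb] := eu (- v).
  have A0 : A !=set0.
    exists (l (- a *: e)); exists (- a *: e) => //; split.
      by rewrite memvZ.
    by rewrite scaleNr opprK addrC.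
  have bU : b *: e \in U by rewrite memvZ.
  exists (sup A); split.
    move=> x xU Cx; apply: sup_upper_bound; last by exists x.
    split=> //; exists (l (b *: e)) => _ [z [zU Cz] <-]; exact: AB.
  move=> y yU Cy; apply: ge_sup => // _ [z [zU Cz] <-]; exact: AB.
have : P (\dim (U + <[v]>)%VS).
  apply/asboolP; exists (U + <[v]>)%VS => //; split.
    exact: subvP (addvSl _ _) e eU.
  exists (l + (s - l v) *: p).
    by rewrite add_lfunE scale_lfunE le pU // scaler0 addr0.
  move=> _ /memv_addP [u uU [_ /vlineP [a ->] ->]] Cx.
  have pE : p (u + a *: v) = a by rewrite linearD linearZ /= pU // pv add0r; exact: mulr1.
  have -> : (l + (s - l v) *: p)%VF (u + a *: v) = l u + a * s.
    rewrite add_lfunE scale_lfunE pE linearD linearZ /= -addrA; congr (_ + _).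
    by rewrite /GRing.scale /= mulrBl (mulrC _ a) (mulrC _ a) addrC subrK.
  have [a0|a0|a0] := ltgtP a 0.
  - have na : 0 < - a by rewrite oppr_gt0.
    have : s <= l ((- a)^-1 *: u).
      apply: sup_lub; first by rewrite memvZ.
      have -> : (- a)^-1 *: u - v = (- a)^-1 *: (u + a *: v).
        by rewrite scalerDr scalerA invrN mulNr mulVf ?lt_eqF // scaleN1r.
      by apply: CZ => //; rewrite invr_ge0 ltW.
    rewrite linearZ /= [X in _ <= X -> _]mulrC ler_pdivlMr // mulrN.
    by rewrite -subr_ge0 opprK mulrC.
  - have : l (- a^-1 *: u) <= s.
      apply: sup_ub; first by rewrite memvZ.
      have -> : v - - a^-1 *: u = a^-1 *: (u + a *: v).
        by rewrite scalerDr scalerA mulVf ?gt_eqF // scale1r scaleNr opprK addrC.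
      by apply: CZ => //; rewrite invr_ge0 ltW.
    rewrite linearZ /= [X in X <= _ -> _]mulNr [_^-1 * _]mulrC lerNl.
    by rewrite ler_pdivlMr // mulNr -subr_ge0 opprK (mulrC s).
  - by move: Cx; rewrite a0 scale0r mul0r !addr0; exact: lC.
move=> /maxm; rewrite -dU => le_dim.
have : (U == U + <[v]>)%VS by rewrite eqEdim addvSl.
by move=> /eqP eU'; move: vU; rewrite eU' memvE addvSr.
Qed.

(** * Supporting functionals of convex cones *)

Lemma cone_order_unitW (R : realType) (V : lmodType R) (C : set V) (e : V) :
  is_cone C -> order_unit C e -> C e.
Proof.
move=> [_ _ CZ] /(_ e) [a a0]; rewrite -[X in _ + X]scale1r -scalerDl => Ca.
have a1 : 0 < a + 1 by rewrite ltr_wpDl.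
have -> : e = (a + 1)^-1 *: ((a + 1) *: e).
  by rewrite scalerA mulVf ?scale1r // gt_eqF.
by apply: CZ => //; rewrite invr_ge0 ltW.
Qed.

(** Moving by a small vector costs at most a small multiple of the order unit,
    coordinate by coordinate, and [a *: e] pays for it. *)
Lemma cone_interior (R : realType) (V : vectType R) (C : set (euclidean V))
    (e k : V) (a : R) :
  is_cone (C : set V) -> order_unit (C : set V) e -> C k -> 0 < a ->
  interior C (k + a *: e).
Proof.
move=> coneC eu Ck a0; have eC := cone_order_unitW coneC eu.
case: coneC => C0 CD CZ.
set f : V := k + a *: e.
have CB (b : V) : exists2 t, 0 <= t & C (t *: e + b) /\ C (t *: e - b).
  have [s s0 Cs] := eu b; have [s' s0' Cs'] := eu (- b).
  exists (s + s'); first exact: addr_ge0.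
  by split; rewrite scalerDl; [rewrite addrAC|rewrite -addrA]; apply: CD => //;
    apply: CZ.
have [T T0 CT] : exists2 T : 'I_(\dim {:V}) -> R, forall i, 0 <= T i &
    forall i, C (T i *: e + (vbasis {:V})`_i) /\ C (T i *: e - (vbasis {:V})`_i).
  have /choice[T TP] : forall i : 'I_(\dim {:V}), exists t,
    0 <= t /\ (C (t *: e + (vbasis {:V})`_i) /\ C (t *: e - (vbasis {:V})`_i)).
    by move=> i; have [t] := CB (vbasis {:V})`_i; exists t.
  by exists T => i; case: (TP i).
(* With coordinates bounded by d = a / t, the basis vectors use up at most
   d (T 1 + ... + T N) e, and d e remains. *)
pose t := 1 + \sum_i T i.
have t0 : 0 < t by rewrite ltr_pwDl // sumr_ge0.
pose d := a / t.
have d0 : 0 < d by rewrite divr_gt0.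
rewrite /interior.
have := @initial_continuous V 'rV[R]_(\dim {:V})
  (fun v : V => \row_i coord (vbasis {:V}) i v) f _ (nbhsx_ballx _ _ d0).
move=> h; apply: (@filterS _ (nbhs (f : euclidean V)) _ _ _ _ h) => v /= fv.
have cE i : `|coord (vbasis {:V}) i (v - f)| < d.
  by case: (fv) => _ /(_ ord0 i); rewrite /ball /= !mxE distrC linearB.
have -> : v = k + d *: e + \sum_i (d * T i *: e + coord (vbasis {:V}) i (v - f) *: (vbasis {:V})`_i).
  rewrite big_split /= -(coord_vbasis (memvf (v - f))) -scaler_suml -mulr_sumr.
  rewrite addrA -(addrA k) -scalerDl -[X in X + _ * _]mulr1 -mulrDr -/t.
  by rewrite /d divfK ?gt_eqF // -/f addrC subrK.
apply: (CD); first by apply: CD => //; apply: CZ => //; exact: ltW.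
elim/big_ind : _ => // i _; move: (cE i) => /ltW; set c := coord _ _ _.
rewrite ler_norml => /andP[c1 c2].
have -> : d * T i *: e + c *: (vbasis {:V})`_i =
  ((d + c) / 2) *: (T i *: e + (vbasis {:V})`_i) +
  ((d - c) / 2) *: (T i *: e - (vbasis {:V})`_i).
  rewrite !scalerDr scalerN addrACA !scalerA -scalerDl -scalerBl.
  by congr (_ *: _ + _ *: _); lra.
have [Cp Cm] := CT i.
by apply: CD; apply: CZ => //; rewrite divr_ge0 //; lra.
Qed.

(** Separation is applied to the cone C - R+ f.  If it contained - e, then [f]
    would be an element of C plus a positive multiple of [e], hence interior.
    As it contains both f and - f, the functional vanishes at [f]. *)
Lemma supporting_functional (R : realType) (V : vectType R) (C : set V) (e f : V) :
  is_cone C -> order_unit C e -> C f -> ~ interior (C : set (euclidean V)) f ->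
  exists2 l : 'Hom(V, R^o), l != 0 /\ l f = 0 & forall x, C x -> 0 <= l x.
Proof.
move=> coneC eu Cf f_bd; have [C0 CD CZ] := coneC.
pose D : set V := [set x | exists2 t, 0 <= t & C (x + t *: f)].
have CsD x : C x -> D x by exists 0 => //; rewrite scale0r addr0.
have coneD : is_cone D.
  split; first exact: CsD.
    move=> x y [s s0 Cs] [t t0 Ct]; exists (s + t); first exact: addr_ge0.
    by rewrite scalerDl addrACA; exact: CD.
  move=> a x a0 [s s0 Cs]; exists (a * s); first exact: mulr_ge0.
  by rewrite -scalerA -scalerDr; exact: CZ.
have eD : order_unit D e.
  by move=> v; have [a a0 Ca] := eu v; exists a => //; exact: CsD.
have De : ~ D (- e).
  move=> [t t0 Ct]; apply: f_bd.
  have t1 : 0 < t + 1 by rewrite ltr_wpDl.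
  have -> : f = (t + 1)^-1 *: (- e + t *: f + f) + (t + 1)^-1 *: e.
    rewrite -scalerDr -(addrA (- e)) [_ + e]addrC addNKr.
    rewrite -[X in _ *: (_ + X)]scale1r -scalerDl scalerA mulVf ?scale1r //.
    by rewrite gt_eqF.
  apply: cone_interior => //; last by rewrite invr_gt0.
  by apply: CZ; [rewrite invr_ge0 ltW|exact: CD].
have [l le lD] := positive_functional coneD eD De.
exists l; last by move=> x /CsD; exact: lD.
split.
  by apply/eqP => l0; move: le => /eqP; rewrite l0 lfunE eq_sym oner_eq0.
have lf : 0 <= l f by apply/lD/CsD.
have lf' : 0 <= l (- f).
  by apply: lD; exists 1 => //; rewrite scale1r addNr.
by apply/eqP; rewrite eq_le lf andbT; move: lf'; rewrite linearN oppr_ge0.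
Qed.

(** * Positive semidefinite forms *)

(** A linear map from V to its dual read as a bilinear form; its kernel is then
    the radical of the form, and is available as a subspace. *)
Definition form (R : comNzRingType) (V : vectType R)
  (B : 'Hom(V, 'Hom(V, R^o))) (p q : V) : R := B p q.

Section Form.
Variables (R : realType) (V : vectType R).
Implicit Types (B M : 'Hom(V, 'Hom(V, R^o))).

Definition form_sym B := forall p q, form B p q = form B q p.
Definition form_psd B := forall p, 0 <= form B p p.

Lemma formDl B p q r : form B (p + q) r = form B p r + form B q r.
Proof. by rewrite /form linearD add_lfunE. Qed.

Lemma formDr B p q r : form B r (p + q) = form B r p + form B r q.
Proof. by rewrite /form linearD. Qed.

Lemma formZl B a p r : form B (a *: p) r = a * form B p r.
Proof. by rewrite /form linearZ scale_lfunE. Qed.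

Lemma formZr B a p r : form B r (a *: p) = a * form B r p.
Proof. by rewrite /form linearZ. Qed.

Lemma mem_radical B p : p \in lker B <-> forall q, form B p q = 0.
Proof.
rewrite memv_ker; split=> [/eqP Bp q|Bp]; first by rewrite /form Bp lfunE.
by apply/eqP/lfunP => q; rewrite lfunE; exact: Bp.
Qed.

(** Isotropic vectors of a positive semidefinite form are in the radical:
    otherwise the form would be negative on some q + t p, as it is affine in t. *)
Lemma psd_radical B p : form_sym B -> form_psd B -> form B p p = 0 -> p \in lker B.
Proof.
move=> symB psdB Bp; apply/mem_radical => q.
apply/eqP/negPn/negP => Bpq; set b := form B p q in Bpq.
pose t := - (form B q q + 1) / (2 * b).
have := psdB (q + t *: p).
rewrite formDl !formDr !formZl !formZr Bp (symB q p) -/b.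
have -> : form B q q + t * b + (t * b + t * (t * 0)) = - 1.
  have : t * (2 * b) = - (form B q q + 1) by rewrite /t divfK ?mulf_neq0 ?pnatr_eq0.
  by lra.
by rewrite lerNr oppr0 ler10.
Qed.

(** A quantitative form of the fact that [M] descends to the quotient by the
    radical of [B], where [B] is definite.  The proof is a Gram-Schmidt process
    carried by a subspace of maximal dimension that has a [B]-orthogonal
    projection and on which the bound holds.  To add one vector, the cross terms
    M u v have to be bounded too, which is why the induction also controls the
    functionals given by M with one argument fixed. *)
Lemma psd_dominates B M : form_sym B -> form_psd B -> form_sym M ->
  (lker B <= lker M)%VS ->
  exists2 c, 0 <= c & forall p, form M p p <= c * form B p p.
Proof.
move=> symB psdB symM BM.
(* The three clauses: projection onto U, bounds for M with one argument
   fixed, bound for the quadratic form of M. *)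
pose P (m : nat) := `[< exists2 U : {vspace V}, \dim U = m &
  [/\ forall v, exists2 u, u \in U & forall w, w \in U -> form B (v - u) w = 0,
      forall q, exists2 c, 0 <= c &
        forall u, u \in U -> form M u q ^+ 2 <= c * form B u u
    & exists2 c, 0 <= c & forall u, u \in U -> form M u u <= c * form B u u] >].
have exP : exists m, P m.
  have form0 B0 q : form B0 0 q = 0 by rewrite -(scale0r q) formZl mul0r.
  exists 0%N; apply/asboolP; exists 0%VS; first exact: dimv0.
  split=> [v|q|].
  - exists 0; first exact: mem0v.
    by move=> w; rewrite memv0 => /eqP ->; rewrite symB form0.
  - exists 0 => // u; rewrite memv0 => /eqP ->.
    by rewrite form0 expr0n mul0r.
  - by exists 0 => // u; rewrite memv0 => /eqP ->; rewrite form0 mul0r.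
have ubP m : P m -> (m <= \dim {:V})%N.
  by move=> /asboolP [U <- _]; apply/dimvS/subvf.
case: (ex_maxnP exP ubP) => m /asboolP [U dU [projU linU quadU]] maxm.
have [UT|/subvPn[v0 _ vU]] := boolP ({:V} <= U)%VS.
  have [c c0 Mc] := quadU; exists c => // p.
  by apply: Mc; exact: subvP UT p (memvf p).
(* Only the component v of v0 orthogonal to U matters. *)
have [u0 u0U] := projU v0; set v := v0 - u0 => ort.
have {}vU : v \notin U.
  by apply: contra vU => vU; rewrite -(subrK u0 v0) memvD.
clearbody v.
suff : P (\dim (U + <[v]>)%VS).
  move=> /maxm; rewrite -dU => le_dim.
  have : (U == U + <[v]>)%VS by rewrite eqEdim addvSl.
  by move=> /eqP eU'; move: vU; rewrite eU' memvE addvSr.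
have BE u a : u \in U ->
    form B (u + a *: v) (u + a *: v) = form B u u + a ^+ 2 * form B v v.
  move=> uU; rewrite formDl !formDr !formZl !formZr (symB u v) ort //.
  by lra.
have := psdB v; rewrite le_eqVlt => /predU1P[/esym Bv0|Bv_gt0].
  have vB := psd_radical symB psdB Bv0.
  have vM : v \in lker M by exact: subvP BM _ vB.
  move: vB vM => /mem_radical vB /mem_radical vM.
  apply/asboolP; exists (U + <[v]>)%VS => //; split.
  - move=> w; have [u uU wu] := projU w.
    exists u; first exact: subvP (addvSl _ _) u uU.
    move=> _ /memv_addP [x xU [_ /vlineP [a ->] ->]].
    by rewrite formDr wu // formZr [form B _ v]symB vB mulr0 addr0.
  - move=> q; have [c c0 Mc] := linU q; exists c => //.
    move=> _ /memv_addP [x xU [_ /vlineP [a ->] ->]].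
    by rewrite BE // Bv0 mulr0 addr0 formDl formZl vM mulr0 addr0 Mc.
  - have [c c0 Mc] := quadU; exists c => //.
    move=> _ /memv_addP [x xU [_ /vlineP [a ->] ->]].
    rewrite BE // Bv0 mulr0 addr0 formDl formZl !formDr !formZr (symM x v) !vM.
    by rewrite !(mulr0, addr0) Mc.
have Bv : form B v v != 0 by rewrite gt_eqF.
apply/asboolP; exists (U + <[v]>)%VS => //; split.
- move=> w; have [u uU wu] := projU w.
  pose a := form B (w - u) v / form B v v.
  exists (u + a *: v).
    by rewrite memv_add ?memvZ ?memv_line.
  move=> _ /memv_addP [x xU [_ /vlineP [b ->] ->]].
  rewrite opprD addrA -scaleNr formDl !formDr !formZl !formZr wu //.
  have : a * form B v v = form B (w - u) v by rewrite /a divfK.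
  by rewrite (ort x xU) => <-; lra.
- move=> q; have [c c0 Mc] := linU q.
  pose k := 2 * form M v q ^+ 2 / form B v v.
  have k0 : 0 <= k by apply: divr_ge0; [rewrite mulr_ge0 // sqr_ge0|exact: ltW].
  exists (2 * c + k); first by rewrite addr_ge0 // mulr_ge0.
  move=> _ /memv_addP [x xU [_ /vlineP [a ->] ->]].
  rewrite BE // formDl formZl.
  have kE : k * form B v v = 2 * form M v q ^+ 2 by rewrite /k divfK.
  have := Mc _ xU; have := psdB x.
  move: (form B x x) (form M x q) => bx mx bx0 mxc.
  have h1 : 0 <= k * bx by rewrite mulr_ge0.
  have h2 : 0 <= c * (a ^+ 2 * form B v v) by rewrite mulr_ge0 // mulr_ge0 // ?sqr_ge0 // ltW.
  have h3 : 0 <= (mx - a * form M v q) ^+ 2 by rewrite sqr_ge0.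
  have h4 : k * (a ^+ 2 * form B v v) = 2 * a ^+ 2 * form M v q ^+ 2.
    by rewrite mulrCA kE; lra.
  move: h1 h2 h3 h4; set y := form M v q; set z := form B v v => h1 h2 h3 h4.
  have -> : (2 * c + k) * (bx + a ^+ 2 * z) =
     2 * (c * bx) + 2 * (c * (a ^+ 2 * z)) + k * bx + k * (a ^+ 2 * z) by lra.
  by rewrite h4; nra.
- have [c c0 Mc] := quadU; have [e e0 Me] := linU v.
  pose k := (1 + `|form M v v|) / form B v v.
  have k0 : 0 <= k by apply: divr_ge0; [rewrite addr_ge0|exact: ltW].
  exists (c + e + k); first by rewrite !addr_ge0.
  move=> _ /memv_addP [x xU [_ /vlineP [a ->] ->]].
  rewrite BE // formDl !formDr !formZl !formZr (symM v x).
  have kE : k * form B v v = 1 + `|form M v v| by rewrite /k divfK.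
  have := Mc _ xU; have := Me _ xU; have := psdB x.
  move: (form B x x) (form M x x) (form M x v) => bx mx mxv bx0 h1 h2.
  have h3 : a * (a * form M v v) <= a ^+ 2 * `|form M v v|.
    by rewrite mulrA -expr2 ler_wpM2l ?sqr_ge0 // ler_norm.
  have h4 : 0 <= k * bx by rewrite mulr_ge0.
  have h5 : 0 <= c * (a ^+ 2 * form B v v) by rewrite mulr_ge0 // mulr_ge0 // ?sqr_ge0 // ltW.
  have h6 : 0 <= e * (a ^+ 2 * form B v v) by rewrite mulr_ge0 // mulr_ge0 // ?sqr_ge0 // ltW.
  have h7 : k * (a ^+ 2 * form B v v) = a ^+ 2 + a ^+ 2 * `|form M v v|.
    by rewrite mulrCA kE; lra.
  have h8 : 0 <= (mxv - a) ^+ 2 by rewrite sqr_ge0.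
  move: h3 h5 h6 h7; set y := form M v v; set z := form B v v; set ny := `|y|.
  move=> h3 h5 h6 h7.
  have -> : (c + e + k) * (bx + a ^+ 2 * z) = c * bx + e * bx + k * bx +
     c * (a ^+ 2 * z) + e * (a ^+ 2 * z) + k * (a ^+ 2 * z) by lra.
  by rewrite h7; nra.
Qed.

End Form.

(** * Products of forms and catalecticants *)

Lemma cone_sum (R : numDomainType) (V : lmodType R) (C : set V) (I : Type)
    (r : seq I) (P : pred I) (F : I -> V) :
  is_cone C -> (forall i, P i -> C (F i)) -> C (\sum_(i <- r | P i) F i).
Proof. by move=> [C0 CD _] CF; elim/big_ind: _. Qed.

(** Finitely many elements of the cone suffice, one pair for each vector of a
    basis and its opposite. *)
Lemma generating_cone_order_unit (R : realFieldType) (V : vectType R) (C : set V) :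
  is_cone C -> (forall v, exists2 s, C s & C (s + v)) -> exists e, order_unit C e.
Proof.
move=> coneC gen; have [C0 CD CZ] := coneC.
have /choice[s sP] : forall v, exists s, C s /\ C (s + v).
  by move=> v; have [s] := gen v; exists s.
pose b i := (vbasis {:V})`_i.
pose e := \sum_(i < \dim {:V}) (s (b i) + s (- b i)).
exists e => v; pose c i := coord (vbasis {:V}) i v.
exists (\sum_i `|c i|); first exact: sumr_ge0.
rewrite (coord_vbasis (memvf v)) scaler_suml -big_split /=.
apply: cone_sum => // i _; rewrite -/(c i) -/(b i).
have Cb j : C (s (b j) + s (- b j)) by apply: CD; case: (sP (b j)); case: (sP (- b j)).
have Ce : C (e - (s (b i) + s (- b i))).
  by rewrite /e (bigD1 i) //= [X in C (X - _)]addrC addrK; apply: cone_sum.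
rewrite -[e](subrK (s (b i) + s (- b i))) scalerDr -addrA.
apply: (CD); first exact: CZ.
have [sp spb] := sP (b i); have [sm smb] := sP (- b i).
have [ci|ci] := leP 0 (c i).
  rewrite ger0_norm // -scalerDr; apply: CZ => //.
  by rewrite addrAC; exact: CD.
rewrite ltr0_norm //.
have -> : c i *: b i = - c i *: - b i by rewrite scalerN scaleNr opprK.
rewrite -scalerDr; apply: CZ; first by rewrite oppr_ge0 ltW.
by rewrite -addrA; exact: CD.
Qed.

Lemma dvd_mnm_mdeg n (m : 'X_{1..n}) k : (k <= mdeg m)%N ->
  exists2 m', (m' <= m)%MM & mdeg m' = k.
Proof.
elim: k => [|k IH] km.
  by exists 0%MM; [apply/mnm_lepP => i; rewrite mnm0E|rewrite mdeg0].
have [m' m'm dm'] := IH (ltnW km).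
have [i mi] : exists i, (m' i < m i)%N.
  apply/existsP; apply: contraTT km; rewrite negb_exists => /forallP le_mm'.
  rewrite -leqNgt -dm' !mdegE; apply: leq_sum => i _.
  by rewrite leqNgt le_mm'.
exists (m' + U_(i))%MM; last by rewrite mdegD mdeg1 dm' addn1.
apply/mnm_lepP => j; rewrite mnmDE mnm1E.
by case: eqP => [<-|_]; rewrite ?addn1 // addn0; exact/mnm_lepP.
Qed.

Lemma mnm_split n (m : 'X_{1..n}) j k : mdeg m = (j + k)%N ->
  exists m1 m2, [/\ m = (m1 + m2)%MM, mdeg m1 = j & mdeg m2 = k].
Proof.
move=> dm; have [|m1 m1m d1] := @dvd_mnm_mdeg _ m j; first by rewrite dm leq_addr.
exists m1, (m - m1)%MM; split=> //; first by rewrite addmC submK.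
by apply/eqP; rewrite -(eqn_add2l j) -{1}d1 -mdegD addmC submK // dm.
Qed.

(** Meaningful when [m] has degree [d]; otherwise this is the default value 0. *)
Definition hmon (R : nzRingType) n d (m : 'X_{1..n}) : dhomog n R d :=
  ['dhomog_d 'X_[m]].

Lemma val_hmon (R : nzRingType) n d (m : 'X_{1..n}) : mdeg m = d ->
  val (hmon R d m) = 'X_[m].
Proof. by move=> dm; rewrite val_insubd dhomogX /= dm eqxx. Qed.

Lemma dhomog_monomials (R : nzRingType) n d (p : dhomog n.+1 R d) :
  p = \sum_(m <- msupp p) p@_m *: hmon R d m.
Proof.
apply: val_inj; rewrite raddf_sum /= {1}[val p]mpolyE.
apply: eq_big_seq => m mp; rewrite val_hmon //.
exact: (dhomog_mf (dhomog_is_dhomog p) mp).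
Qed.

Section Product.
Variables (R : comNzRingType) (n d : nat).
Notation H := (dhomog n.+1 R d).
Notation H2 := (dhomog n.+1 R (2 * d)).

Lemma hmul_subproof (p q : H) : (val p * val q) \is (2 * d).-homog.
Proof. by rewrite mul2n -addnn; apply: dhomogM; apply: dhomog_is_dhomog. Qed.

Definition hmul (p q : H) : H2 := DHomog (hmul_subproof p q).

Lemma val_hmul p q : val (hmul p q) = val p * val q. Proof. by []. Qed.

Lemma hmulC p q : hmul p q = hmul q p.
Proof. by apply: val_inj; rewrite !val_hmul mulrC. Qed.

Lemma hmul_is_linear p : linear (hmul p).
Proof.
move=> a q r; apply: val_inj; rewrite linearP /= mulrDr; congr (_ + _).
by rewrite -scalerAr.
Qed.

HB.instance Definition _ p :=
  GRing.isLinear.Build R H H2 _ (hmul p) (hmul_is_linear p).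

Definition catalecticant_row (L : 'Hom(H2, R^o)) (p : H) : 'Hom(H, R^o) :=
  (L \o linfun (hmul p))%VF.

Lemma catalecticant_rowE L p q : catalecticant_row L p q = L (hmul p q).
Proof. by rewrite comp_lfunE lfunE. Qed.

Lemma catalecticant_row_is_linear L : linear (catalecticant_row L).
Proof.
move=> a p q; apply/lfunP => r.
rewrite add_lfunE scale_lfunE !catalecticant_rowE !(hmulC _ r).
by rewrite !linearP.
Qed.

HB.instance Definition _ L :=
  GRing.isLinear.Build R H 'Hom(H, R^o) _ (catalecticant_row L)
    (catalecticant_row_is_linear L).

(** The middle catalecticant of [L], that is, the bilinear form L (p q) on forms
    of degree d. *)
Definition catalecticant (L : 'Hom(H2, R^o)) : 'Hom(H, 'Hom(H, R^o)) :=
  linfun (catalecticant_row L).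

Lemma form_catalecticant L p q : form (catalecticant L) p q = L (hmul p q).
Proof. by rewrite /form lfunE catalecticant_rowE. Qed.

Lemma hmon_factor m : mdeg m = (2 * d)%N ->
  exists p q : H, hmon R (2 * d) m = hmul p q.
Proof.
move=> dm; have [|m1 [m2 [em d1 d2]]] := @mnm_split _ m d d.
  by rewrite dm mul2n -addnn.
exists (hmon R d m1), (hmon R d m2); apply: val_inj.
by rewrite val_hmul !val_hmon // em mpolyXD.
Qed.

End Product.

(** * Extremal functionals on sums of squares *)

Section SumsOfSquares.
Variables (R : realType) (n d : nat).
Notation H := (dhomog n.+1 R d).
Notation H2 := (dhomog n.+1 R (2 * d)).
Notation sos := (@sos_cone R n.+1 d).
Implicit Types (L M : 'Hom(H2, R^o)) (p q : H).

Lemma sosP (f : H2) :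
  sos f <-> exists ps : seq H, f = \sum_(p <- ps) hmul p p.
Proof.
split=> -[ps fE]; exists ps.
  by apply: val_inj; rewrite raddf_sum.
by rewrite fE raddf_sum.
Qed.

Lemma is_cone_sos : is_cone sos.
Proof.
split.
- by apply/sosP; exists [::]; rewrite big_nil.
- move=> f g /sosP[ps ->] /sosP[qs ->]; apply/sosP; exists (ps ++ qs).
  by rewrite big_cat.
- move=> a f a0 /sosP[ps ->]; apply/sosP.
  exists [seq Num.sqrt a *: p | p <- ps]; rewrite big_map scaler_sumr.
  apply: eq_bigr => p _; apply: val_inj; rewrite /= -scalerAl -scalerAr scalerA.
  by rewrite -[Num.sqrt a * _]expr2 sqr_sqrtr.
Qed.

Lemma sos_square p : sos (hmul p p).
Proof. by apply/sosP; exists [:: p]; rewrite big_seq1. Qed.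

(** By polarization, a product p q plus (p^2 + q^2) / 2 is a square up to a
    factor, and every monomial of degree 2d is a product of two of degree d. *)
Lemma sos_generating (v : H2) : exists2 s, sos s & sos (s + v).
Proof.
have [sos0 sosD sosZ] := is_cone_sos.
suff : forall (r : seq 'X_{1..n.+1}) (c : 'X_{1..n.+1} -> R),
    (forall m, m \in r -> mdeg m = (2 * d)%N) ->
    exists2 s, sos s & sos (s + \sum_(m <- r) c m *: hmon R (2 * d) m).
  rewrite (dhomog_monomials v); apply=> m.
  exact: (dhomog_mf (dhomog_is_dhomog v)).
elim=> [|m r IH] c rP; first by exists 0 => //; rewrite big_nil addr0.
have [|s sosS sosSv] := IH c; first by move=> k kr; apply: rP; rewrite inE kr orbT.
have [|p [q pq]] := @hmon_factor R n d m; first by apply: rP; rewrite inE eqxx.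
pose t := (2^-1 * `|c m|) *: (hmul p p + hmul q q).
exists (s + t).
  apply: (sosD) => //; apply: (sosZ); first by rewrite mulr_ge0 // invr_ge0.
  by apply: (sosD); exact: sos_square.
rewrite big_cons [X in _ + X]addrC addrACA; apply: (sosD) => //.
pose e : R := Num.sg (c m).
have -> : t + c m *: hmon R (2 * d) m =
    (2^-1 * `|c m|) *: hmul (p + e *: q) (p + e *: q).
  apply: val_inj; rewrite pq /= -[in c m *: _](mulr_sg_norm (c m)) -/e.
  rewrite mulrDl !mulrDr -!scalerAl -!scalerAr !scalerA.
  rewrite !scalerDr !scalerA.
  have [c0|c0] := eqVneq (c m) 0.
    by rewrite c0 normr0 !(mulr0, mul0r, scale0r, addr0).
  have ee : e * e = 1 by rewrite /e -expr2 sqr_sg c0.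
  rewrite -!mulrA ee mulr1 [(q : {mpoly R[_]}) * p]mulrC.
  rewrite -!addrA; congr (_ + _); rewrite addrA -scalerDl [LHS]addrC.
  by congr (_ *: _ + _); lra.
by apply: (sosZ); [rewrite mulr_ge0 // invr_ge0|exact: sos_square].
Qed.

Definition psd_functional L := forall p, 0 <= L (hmul p p).

Lemma psd_functional_sos L : psd_functional L <-> forall f, sos f -> 0 <= L f.
Proof.
split=> [Lp f /sosP[ps ->]|Lf p]; last by apply: Lf; exact: sos_square.
by rewrite linear_sum; apply: sumr_ge0 => p _; exact: Lp.
Qed.

Lemma form_sym_catalecticant L : form_sym (catalecticant L).
Proof. by move=> p q; rewrite !form_catalecticant hmulC. Qed.

Lemma form_psd_catalecticant L :
  psd_functional L <-> form_psd (catalecticant L).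
Proof. by split=> h p; have := h p; rewrite form_catalecticant. Qed.

Definition apolar_kernel L : {vspace H} := lker (catalecticant L).

Lemma apolar_kernelP L p : p \in apolar_kernel L <-> forall q, L (hmul p q) = 0.
Proof.
rewrite mem_radical; split=> h q; have := h q; by rewrite form_catalecticant.
Qed.

Lemma squares_in_kernel L (ps : seq H) : psd_functional L ->
  L (\sum_(p <- ps) hmul p p) = 0 -> {subset ps <= apolar_kernel L}.
Proof.
move=> psdL; rewrite linear_sum => /eqP.
rewrite psumr_eq0 => [/allP Lp p /Lp /eqP L0|p _]; last exact: psdL.
apply: psd_radical; [exact: form_sym_catalecticant|exact/form_psd_catalecticant|].
by rewrite form_catalecticant.
Qed.

Lemma functional0 L : (forall p, L (hmul p p) = 0) -> L = 0.
Proof.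
move=> L0; apply/lfunP => v; rewrite lfunE /=.
have Ls s : sos s -> L s = 0 by move=> /sosP[ps ->]; rewrite linear_sum big1 // => p _; exact: L0.
have [s /Ls ss /Ls] := sos_generating v.
by rewrite linearD /= ss add0r.
Qed.

(** A supporting functional whose kernel has maximal dimension is extremal: along
    the half-line L - t M, the last positive semidefinite functional would have a
    strictly larger kernel. *)
Lemma extremal_functional (f : H2) : sos f ->
    ~ interior (sos : set (euclidean H2)) f ->
  exists L : 'Hom(H2, R^o), [/\ L != 0, L f = 0, psd_functional L &
    forall M, (forall p q, p \in apolar_kernel L -> M (hmul p q) = 0) ->
      exists c, M = c *: L].
Proof.
move=> fsos f_bd.
have /sosP[ps fE] := fsos.
pose P m := `[< exists2 L : 'Hom(H2, R^o), [/\ L != 0, L f = 0 & psd_functional L] &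
                  \dim (apolar_kernel L) = m >].
have exP : exists m, P m.
  have [e eu] := generating_cone_order_unit is_cone_sos sos_generating.
  have [L [L0 Lf] /psd_functional_sos Lp] :=
    supporting_functional is_cone_sos eu fsos f_bd.
  by exists (\dim (apolar_kernel L)); apply/asboolP; exists L.
have ubP m : P m -> (m <= \dim {:H})%N.
  by move=> /asboolP [L _ <-]; apply/dimvS/subvf.
case: (ex_maxnP exP ubP) => m /asboolP [L [L0 Lf psdL] dL] maxm.
exists L; split=> // M MK.
apply: contrapT => ML.
have {}ML c : M <> c *: L by move=> Mc; apply: ML; exists c.
(* Up to a sign, M is positive on some square, which bounds the set T below. *)
wlog [p0 Mp0] : M MK ML / exists p, 0 < M (hmul p p).
  move=> wl; have [p Mp] : exists p, M (hmul p p) != 0.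
    apply: contrapT => M0; apply: (ML 0); rewrite scale0r; apply: functional0 => p.
    by apply/eqP/negPn/negP => Mp; apply: M0; exists p.
  case: (ltgtP (M (hmul p p)) 0) Mp => // [Mp|Mp] _.
    apply: (wl (- M)).
    - by move=> q r qL; rewrite opp_lfunE MK ?oppr0.
    - move=> c Mc; apply: (ML (- c)).
      by rewrite scaleNr -Mc opprK.
    - by exists p; rewrite opp_lfunE oppr_gt0.
  by apply: (wl M) => //; exists p.
(* The set T of admissible multiples has a largest element t, and N below is
   L - t M.  The kernel of N contains that of L, hence equals it by maximality;
   but then M is dominated by N, and a larger multiple is admissible. *)
pose T : set R := [set t | 0 <= t /\ psd_functional (L - t *: M)].
have TE t p : (L - t *: M)%VF (hmul p p) = L (hmul p p) - t * M (hmul p p).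
  by rewrite add_lfunE opp_lfunE scale_lfunE.
have T0 : T 0 by split=> // p; rewrite TE mul0r subr0.
have Tub t p : T t -> t * M (hmul p p) <= L (hmul p p).
  by move=> [_ /(_ p)]; rewrite TE subr_ge0.
have hsT : has_sup T.
  split; first by exists 0.
  exists (L (hmul p0 p0) / M (hmul p0 p0)) => t /(Tub t p0).
  by rewrite ler_pdivlMr.
pose t := sup T.
have t0 : 0 <= t by exact: ub_le_sup hsT.2 _ T0.
have Tt : T t.
  split=> // p; rewrite TE subr_ge0.
  have [Mp|Mp] := leP (M (hmul p p)) 0.
    by apply: le_trans (psdL p); rewrite mulr_ge0_le0.
  rewrite -ler_pdivlMr //; apply: ge_sup; first by exists 0.
  by move=> s /(Tub s p); rewrite ler_pdivlMr.
pose N := L - t *: M.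
have psdN : psd_functional N by case: Tt.
have N0 : N != 0.
  rewrite subr_eq0; apply/eqP => LtM.
  have tn0 : t != 0.
    by apply: contra_neq L0 => t00; rewrite LtM t00 scale0r.
  by apply: (ML t^-1); rewrite LtM scalerA mulVf // scale1r.
have Kps : {subset ps <= apolar_kernel L}.
  by apply: squares_in_kernel => //; rewrite -fE.
have Mf : M f = 0.
  rewrite fE linear_sum big_seq big1 //= => p pps.
  by rewrite MK //; exact: Kps.
have Nf : N f = 0 by rewrite add_lfunE opp_lfunE scale_lfunE Lf Mf scaler0 subr0.
have LN : (apolar_kernel L <= apolar_kernel N)%VS.
  apply/subvP => p pL; apply/apolar_kernelP => q.
  rewrite add_lfunE opp_lfunE scale_lfunE MK // scaler0 subr0.
  by move: q; apply/apolar_kernelP.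
have eN : apolar_kernel N = apolar_kernel L.
  apply/esym/eqP; rewrite eqEdim LN dL; apply: maxm; apply/asboolP.
  by exists N.
have [|c c0 Mc] := psd_dominates (form_sym_catalecticant N)
    (iffLR (form_psd_catalecticant N) psdN) (form_sym_catalecticant M).
  rewrite -/(apolar_kernel N) -/(apolar_kernel M) eN.
  by apply/subvP => p pL; apply/apolar_kernelP => q; exact: MK.
have c1 : 0 < c + 1 by rewrite ltr_wpDl.
suff : T (t + (c + 1)^-1).
  move=> /(ub_le_sup hsT.2); rewrite -/t -lerBrDl subrr.
  by rewrite leNgt invr_gt0 c1.
split; first by rewrite addr_ge0 // invr_ge0 ltW.
move=> p; have yc := Mc p; rewrite !form_catalecticant TE in yc.
have x0 := psdN p; rewrite TE in x0.
rewrite TE mulrDl opprD addrA subr_ge0 mulrC ler_pdivrMr // mulrC.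
by apply: le_trans yc _; rewrite ler_wpM2r // lerDl.
Qed.

End SumsOfSquares.

(** * Ideals and homogeneity *)

Section IdealTheory.
Variable A : comNzRingType.
Implicit Types (I G : set A) (x y a : A).

Lemma ideal_gen_is_ideal G : is_ideal (ideal_gen G).
Proof.
split; first by move=> I [[I0 _ _] _].
  by move=> x y xG yG I II; have [[_ ID _] _] := II; apply: ID; [exact: xG|exact: yG].
by move=> a x xG I II; have [[_ _ IM] _] := II; apply: IM; exact: xG.
Qed.

Lemma sub_ideal_gen G : G `<=` ideal_gen G.
Proof. exact: sub_gen_smallest. Qed.

Lemma ideal_gen_min G I : is_ideal I -> G `<=` I -> ideal_gen G `<=` I.
Proof. exact: smallest_sub. Qed.

Lemma idealN I x : is_ideal I -> I x -> I (- x).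
Proof. by move=> [_ _ IM] Ix; rewrite -mulN1r; exact: IM. Qed.

Lemma idealB I x y : is_ideal I -> I x -> I y -> I (x - y).
Proof. by move=> II Ix Iy; case: (II) => _ ID _; apply: ID => //; exact: idealN. Qed.

Lemma ideal_sum I (J : Type) (r : seq J) (P : pred J) (F : J -> A) :
  is_ideal I -> (forall i, P i -> I (F i)) -> I (\sum_(i <- r | P i) F i).
Proof. by move=> [I0 ID _] IF; elim/big_ind: _. Qed.

Lemma idealMr I x a : is_ideal I -> I x -> I (x * a).
Proof. by move=> [_ _ IM] Ix; rewrite mulrC; exact: IM. Qed.

Lemma ideal_subKr I x y : is_ideal I -> I (x - y) -> I y -> I x.
Proof. by move=> [_ ID _] Ixy Iy; rewrite -(subrK y x); exact: ID. Qed.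

Lemma ideal_subl I x y : is_ideal I -> I (x - y) -> I x -> I y.
Proof.
move=> II Ixy Ix; have -> : y = x - (x - y) by rewrite opprB addrC subrK.
exact: idealB.
Qed.

Lemma ideal_sub_trans I x y z : is_ideal I -> I (x - y) -> I (y - z) -> I (x - z).
Proof. by move=> [_ ID _] Ixy Iyz; rewrite -(subrK y x) -addrA; exact: ID. Qed.

Lemma ideal_congrX I x y k : is_ideal I -> I (x - y) -> I (x ^+ k - y ^+ k).
Proof. by move=> II Ixy; rewrite subrXX; exact: idealMr. Qed.

Lemma radical_is_ideal I : is_ideal I -> is_ideal (radical I).
Proof.
move=> II; have [I0 ID IM] := II; split; first by exists 1%N; rewrite expr1.
  move=> x y [k Ix] [l Iy]; exists (k + l)%N.
  rewrite exprDn; apply: ideal_sum => // -[i /= ikl] _.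
  rewrite -mulr_natr; apply: idealMr => //.
  have [il|il] := leqP l i.
    by rewrite -(subnK il) exprD; do 2!apply: (IM).
  have ki : (k <= k + l - i)%N by rewrite leq_subRL; lia.
  by rewrite -(subnK ki) exprD; apply: idealMr => //; apply: (IM).
by move=> a x [k Ix]; exists k; rewrite exprMn; exact: IM.
Qed.

Lemma radical_radical I x : radical (radical I) x -> radical I x.
Proof. by move=> [k [l]]; rewrite -exprM; exists (k * l)%N. Qed.

Lemma sub_radical I : I `<=` radical I.
Proof. by move=> x Ix; exists 1%N; rewrite expr1. Qed.

Lemma radicalS I J : I `<=` J -> radical I `<=` radical J.
Proof. by move=> IJ x [k /IJ]; exists k. Qed.

End IdealTheory.

Lemma idealZ (R : comNzRingType) n (I : set {mpoly R[n]}) c p :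
  is_ideal I -> I p -> I (c *: p).
Proof. by move=> [_ _ IM] Ip; rewrite -mul_mpolyC; exact: IM. Qed.

Section HomogeneousIdeals.
Variables (R : realType) (n : nat).
Implicit Types (p q : {mpoly R[n]}) (I G : set {mpoly R[n]}).

Lemma pihomog_mull d k p q : p \is d.-homog ->
  pihomog mdeg (d + k) (p * q) = p * pihomog mdeg k q.
Proof.
move=> hp; pose l := maxn k.+1 (mmeasure mdeg q).
rewrite [in LHS](pihomog_partitionE (leq_maxr k.+1 (mmeasure mdeg q))) -/l.
have kl : (k < l)%N by rewrite leq_max ltnSn.
rewrite mulr_sumr raddf_sum /= (bigD1 (Ordinal kl)) //= big1 ?addr0.
  by apply: pihomog_dE; apply: dhomogM => //; exact: pihomogP.
move=> i ik; apply: (@pihomog_ne0 _ _ _ (d + i)); last first.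
  by apply: dhomogM => //; exact: pihomogP.
by rewrite eqn_add2l; apply: contra ik => /eqP ik; apply/eqP/val_inj.
Qed.

Lemma pihomog_mull0 d k p q : p \is d.-homog -> (k < d)%N ->
  pihomog mdeg k (p * q) = 0.
Proof.
move=> hp kd.
rewrite (pihomog_partitionE (leqnn (mmeasure mdeg q))) mulr_sumr raddf_sum /= big1 //.
move=> i _; apply: (@pihomog_ne0 _ _ _ (d + i)); last first.
  by apply: dhomogM => //; exact: pihomogP.
by rewrite neq_ltn ltn_addr ?orbT.
Qed.

(** The elements all of whose homogeneous components are in the ideal form an
    ideal that contains the generators. *)
Lemma ideal_gen_homog G : (forall g, G g -> exists d, g \is d.-homog) ->
  is_homog_ideal (ideal_gen G).
Proof.
move=> Gh; set I := ideal_gen G; have II : is_ideal I := ideal_gen_is_ideal G.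
have [I0 ID IM] := II; split=> // p k Ip.
pose T := [set p | forall k, I (pihomog mdeg k p)].
suff /(_ p Ip k) : I `<=` T by [].
apply: ideal_gen_min; last first.
  move=> g Gg l; have [d hg] := Gh _ Gg.
  have [<-|dl] := eqVneq d l; first by rewrite pihomog_dE //; exact: sub_ideal_gen.
  by rewrite (pihomog_ne0 dl hg).
split=> [l|x y Tx Ty l|a x Tx l].
- by rewrite raddf0.
- by rewrite raddfD; apply: ID; [exact: Tx|exact: Ty].
- rewrite [a]mpolyE mulr_suml raddf_sum; apply: ideal_sum => // m _.
  rewrite /= -scalerAl linearZ /=; apply: (idealZ _ II).
  have hm : 'X_[R, m] \is (mdeg m).-homog by rewrite dhomogX.
  have [ml|ml] := leqP (mdeg m) l; last by rewrite (pihomog_mull0 _ hm).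
  by rewrite -(subnKC ml) pihomog_mull //; exact: IM.
Qed.

End HomogeneousIdeals.

(** * The ideal of an extremal functional *)

Section ApolarIdeal.
Variables (R : realType) (n d : nat).
Notation H := (dhomog n.+1 R d).
Notation H2 := (dhomog n.+1 R (2 * d)).
Variable L : 'Hom(H2, R^o).

Definition apolar_gens : set {mpoly R[n.+1]} :=
  [set val p | p in [set p | p \in apolar_kernel L]].

Definition apolar_ideal : set {mpoly R[n.+1]} := ideal_gen apolar_gens.

Lemma apolar_ideal_is_ideal : is_ideal apolar_ideal.
Proof. exact: ideal_gen_is_ideal. Qed.

Let II := apolar_ideal_is_ideal.

Lemma apolar_ideal_homog : is_homog_ideal apolar_ideal.
Proof. by apply: ideal_gen_homog => _ [p _ <-]; exists d; exact: dhomog_is_dhomog. Qed.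

Definition hpart k (P : {mpoly R[n.+1]}) : dhomog n.+1 R k := DHomog (pihomogP mdeg k P).

(** The elements that satisfy the conclusion for all [Q] form an ideal (the full
    annihilator of [L], a Gorenstein ideal), which contains the generators.  All
    upper bounds on the ideal come from this inclusion. *)
Lemma apolar_ideal_annihilates P Q :
  apolar_ideal P -> L (hpart (2 * d) (P * Q)) = 0.
Proof.
have hpartD k p q : hpart k (p + q) = hpart k p + hpart k q.
  by apply: val_inj; rewrite /= raddfD.
pose T := [set P | forall Q, L (hpart (2 * d) (P * Q)) = 0].
move=> IP; suff /(_ P IP Q) : apolar_ideal `<=` T by [].
apply: ideal_gen_min.
  split=> [q|x y Tx Ty q|a x Tx q].
  - have -> : hpart (2 * d) (0 * q) = 0 by apply: val_inj; rewrite /= mul0r raddf0.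
    exact: linear0.
  - by rewrite mulrDl hpartD linearD /= Tx Ty addr0.
  - by rewrite mulrAC mulrC; exact: Tx.
move=> _ [p /apolar_kernelP pL <-] q.
have -> : hpart (2 * d) (val p * q) = hmul p (hpart d q).
  by apply: val_inj; rewrite /= mul2n -addnn pihomog_mull; last exact: (dhomog_is_dhomog p).
exact: pL.
Qed.

Lemma apolar_ideal_deg (p : H) : apolar_ideal (val p) <-> p \in apolar_kernel L.
Proof.
split=> [Ip|pL]; last by apply: sub_ideal_gen; exists p.
apply/apolar_kernelP => q; have := apolar_ideal_annihilates (val q) Ip.
by congr (L _ = 0); apply: val_inj; rewrite /= pihomog_dE //; exact: (dhomog_is_dhomog (hmul p q)).
Qed.

Lemma apolar_ideal_deg2 (v : H2) : apolar_ideal (val v) -> L v = 0.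
Proof.
move=> Iv; have := apolar_ideal_annihilates 1 Iv.
by congr (L _ = 0); apply: val_inj; rewrite /= mulr1 pihomog_dE //; exact: (dhomog_is_dhomog v).
Qed.

Hypothesis extL : forall M : 'Hom(H2, R^o),
  (forall p q, p \in apolar_kernel L -> M (hmul p q) = 0) -> exists c, M = c *: L.

(** If some form [v] with L v = 0 were missing from the degree 2d piece, a
    functional separating it from that piece would be a multiple of [L] by
    extremality, and yet would not vanish at [v]. *)
Lemma extremal_apolar_deg2 (v : H2) : L v = 0 -> apolar_ideal (val v).
Proof.
move=> Lv; apply/(graded_partP II v)/negPn/negP => vU.
have [M MU Mv] := separating_functional vU.
have [|c Mc] := extL (M := M).
  move=> p q /apolar_ideal_deg Ip; apply: MU; apply/(graded_partP II).
  exact: (idealMr _ II Ip).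
by move: Mv; rewrite Mc scale_lfunE Lv scaler0 => /esym/eqP; rewrite oner_eq0.
Qed.

(** The quotient by the ideal is one-dimensional in degree 2d.  If it did not
    vanish in high degrees, multiplication by the variables on its tail would
    make [L] proportional to the evaluation at a real point, which is impossible
    as L f = 0 < f(lam).  The computation below shows directly that
    the powers x_i^(4d) vanish in the quotient. *)
Lemma extremal_apolar_nilpotent (f : H2) : (0 < d)%N -> L != 0 -> L f = 0 ->
  strictly_positive f -> forall i, radical apolar_ideal 'X_i.
Proof.
move=> d0 L0 Lf fpos i; have [I0 ID IM] := II.
have [a [da La]] : exists a : 'X_{1..n.+1}, mdeg a = (2 * d)%N /\ L (hmon R (2 * d) a) != 0.
  apply: contrapT => La; move: L0; apply/negP/negPn/eqP/lfunP => v.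
  rewrite lfunE (dhomog_monomials v) linear_sum big_seq big1 //= => m mv.
  rewrite linearZ /=; apply/eqP; rewrite [_ == _]mulf_eq0; apply/orP; right.
  apply/negPn/negP => Lm; apply: La; exists m; split=> //.
  exact: (dhomog_mf (dhomog_is_dhomog v) mv).
pose c := L (hmon R (2 * d) a).
pose u : H2 := c^-1 *: hmon R (2 * d) a.
have Lu : L u = 1 by rewrite linearZ /= [LHS]mulVf.
have [j [b ea]] : exists j b, a = (U_(j) + b)%MM.
  have [j aj] : exists j, a j != 0%N.
    apply/existsP; apply: contraTT d0; rewrite negb_exists => /forallP a0.
    rewrite -leqNgt -(leq_pmul2l (isT : (0 < 2)%N)) muln0 -da mdegE big1 // => j _.
    by apply/eqP; have := a0 j; rewrite negbK.
  by exists j, (a - U_(j))%MM; rewrite addmC submK // lep1mP.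
have db : (mdeg b + 1 = 2 * d)%N by rewrite -da ea mdegD mdeg1 addnC.
pose v0 : {mpoly R[n.+1]} := c^-1 *: 'X_[b].
have hXv0 k : 'X_k * v0 \is (2 * d).-homog.
  by rewrite -db addnC -scalerAr dhomogZ // -mpolyXD dhomogX /= mdegD mdeg1.
have uE : val u = 'X_j * v0.
  by rewrite -scalerAr -mpolyXD -ea /= val_hmon.
clearbody u v0.
(* In degree 2d every form is congruent to a multiple of u. *)
have modu (v : H2) : apolar_ideal (val v - L v *: val u).
  have := @extremal_apolar_deg2 (v - L v *: u).
  by apply; rewrite linearB linearZ /= Lu [X in _ - X]mulr1 subrr.
pose lam k : R := L (DHomog (hXv0 k)).
have lamj : lam j = 1.
  by rewrite /lam -Lu; congr (L _); apply: val_inj; rewrite uE.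
(* x_k u = x_j (x_k v0), and x_k v0 is congruent to lam_k u. *)
have Xu k : apolar_ideal ('X_k * val u - lam k *: ('X_j * val u)).
  have -> : 'X_k * val u - lam k *: ('X_j * val u) =
      'X_j * (val (DHomog (hXv0 k)) - lam k *: val u).
    by rewrite mulrBr -scalerAr; congr (_ - _); rewrite uE mulrCA.
  by apply: (IM); exact: modu.
have Xmu m : apolar_ideal ('X_[m] * val u - ('X_[m]).@[lam] *: ('X_j ^+ mdeg m * val u)).
  move: {2}(mdeg m) (erefl (mdeg m)) => l; elim: l m => [|l IH] m dm.
    have /eqP m0 : m == 0%MM by rewrite -mdeg_eq0 dm.
    by rewrite m0 mpolyX0 meval1 mdeg0 expr0 scale1r subrr.
  have [|m1 [m2 [-> /eqP/mdeg1P[k /eqP ->] dm2]]] := @mnm_split _ m 1 l.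
    by rewrite dm.
  rewrite mdegD mdeg1 mpolyXD mevalM mevalXU exprS.
  have e1 := IM 'X_[m2] _ (Xu k).
  have e2 := idealZ (lam k) II (IM 'X_j _ (IH _ dm2)).
  apply: (@ideal_sub_trans _ _ _ (lam k *: ('X_j * ('X_[m2] * val u))) _ II).
    by move: e1; rewrite mulrBr -scalerAr !(mulrCA 'X_[m2]) [X in apolar_ideal (X - _)]mulrA.
  by move: e2; rewrite mulrBr scalerBr -scalerAr scalerA [X in _ - _ *: X]mulrA dm2.
have Pu (v : H2) : apolar_ideal
    (val v * val u - (val v).@[lam] *: ('X_j ^+ (2 * d) * val u)).
  rewrite {1 2}[val v]mpolyE mulr_suml raddf_sum scaler_suml -sumrB.
  rewrite big_seq; apply: (ideal_sum _ II) => m mv.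
  have dm := dhomog_mf (dhomog_is_dhomog v) mv.
  rewrite /= mevalZ -scalerAl -scalerA -scalerBr; apply: (idealZ _ II).
  by rewrite -[in 'X_j ^+ _]dm; exact: Xmu.
(* The point lam is nonzero, since its coordinate j is L u = 1. *)
have flam : (val f).@[lam] != 0.
  by rewrite gt_eqF //; apply: fpos; exists j; rewrite lamj oner_neq0.
have Xju : apolar_ideal ('X_j ^+ (2 * d) * val u).
  have : apolar_ideal ((val f).@[lam] *: ('X_j ^+ (2 * d) * val u)).
    apply: (ideal_subl II (Pu f)); apply: (idealMr _ II).
    exact: extremal_apolar_deg2.
  by move=> /(idealZ (val f).@[lam]^-1 II); rewrite scalerA mulVf // scale1r.
(* X_i^(2d) is congruent to a multiple of u, and its product with u is in the
   ideal; hence so is its square. *)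
pose m := (U_(i) *+ (2 * d))%MM.
have dm : mdeg m = (2 * d)%N by rewrite mdegMn mdeg1 mul1n.
have mu : apolar_ideal ('X_[m] * val u).
  by apply: (ideal_subKr II (Xmu m)); apply: (idealZ _ II); rewrite dm.
exists (2 * d + 2 * d)%N; rewrite exprD mpolyXn -/m.
have := modu (hmon R (2 * d) m); rewrite val_hmon // => /(IM 'X_[m]).
rewrite mulrBr -scalerAr => /(ideal_subKr II); apply.
exact: (idealZ _ II).
Qed.

End ApolarIdeal.

(** * Points where a polynomial does not vanish *)

(** Separating the last variable loses no information: a monomial is determined
    by the exponent of the last variable and the remaining exponents. *)
Lemma muni_eq0 (R : comNzRingType) n (p : {mpoly R[n.+1]}) : muni p = 0 -> p = 0.
Proof.
move=> p0; apply/mpolyP => m; rewrite mcoeff0; apply/eqP; rewrite mcoeff_eq0.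
apply/negP => mp; move: (mp); rewrite mcoeff_msupp => /negP; apply; apply/eqP.
pose m' := [multinom m (widen_ord (leqnSn n) i) | i < n].
have : ((muni p)`_(m ord_max))@_m' = 0 by rewrite p0 coef0 mcoeff0.
rewrite muniE coef_sum raddf_sum /= (bigD1_seq m) ?msupp_uniq //= big1 ?addr0.
  by rewrite coefZ coefXn eqxx mulr1 mcoeffZ mcoeffX eqxx mulr1.
move=> k km; rewrite coefZ coefXn; case: eqP => [mk|_]; last by rewrite mulr0 mcoeff0.
rewrite mulr1 mcoeffZ mcoeffX; case: eqP => [ek|_]; last by rewrite mulr0.
case/negP: km; apply/eqP/mnmP => i.
have [->//|ni] := eqVneq i ord_max.
have lin : (i < n)%N by rewrite ltn_neqAle -ltnS ltn_ord andbT -(inj_eq val_inj) in ni *.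
move/mnmP/(_ (Ordinal lin)): ek; rewrite !mnmE.
by have -> : widen_ord (leqnSn n) (Ordinal lin) = i by apply: val_inj.
Qed.

Lemma horner_muni (R : comNzRingType) n (p : {mpoly R[n.+1]}) (v : 'I_n.+1 -> R) :
  (map_poly (meval (fun i => v (widen_ord (leqnSn n) i))) (muni p)).[v ord_max] = p.@[v].
Proof.
rewrite muniE raddf_sum horner_sum mevalE; apply: eq_bigr => m _ /=.
rewrite map_polyZ hornerZ map_polyXn hornerXn big_ord_recr /= mulrA.
congr (_ * _); rewrite mevalZ mevalX; congr (_ * _).
by apply: eq_bigr => i _; rewrite mnmE.
Qed.

(** Induction on the number of variables: specialize the first ones so that the
    leading coefficient in the last one survives, then avoid finitely many roots. *)
Lemma mpoly_nonroot (R : numDomainType) n (p : {mpoly R[n]}) :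
  p != 0 -> exists v, p.@[v] != 0.
Proof.
elim: n p => [|n IH] p p0.
  exists (fun=> 0); move: p0; rewrite {1 2}(nvar0_mpolyC p) mevalC.
  by apply: contra => /eqP ->; rewrite mpolyC0.
have u0 : muni p != 0 by apply: contra_neq p0; exact: muni_eq0.
have [v v0] : exists v, (lead_coef (muni p)).@[v] != 0.
  by apply: IH; rewrite lead_coef_eq0.
pose q := map_poly (meval v) (muni p).
have q0 : q != 0.
  apply: contraNneq v0 => q0; rewrite -[X in X == _](coef_map (meval v)).
  by rewrite -/q q0 coef0.
have [x qx] : exists x, q.[x] != 0.
  apply: contrapT => qx.
  have := max_poly_roots q0 (rs := [seq i%:R | i <- iota 0 (size q)]).
  rewrite size_map size_iota ltnn => /(_ _ _)/notF; apply.
    apply/allP => _ /mapP[i _ ->]; apply/negPn/negP => qi; apply: qx.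
    by exists i%:R.
  rewrite map_inj_uniq ?iota_uniq // => i j /eqP.
  by rewrite eqr_nat => /eqP.
(* The last index n is out of range for v and receives the value x. *)
exists (fun i => oapp v x (insub (val i))).
rewrite -horner_muni insubF ?ltnn //=.
suff -> : meval (fun i : 'I_n => oapp v x (insub (val i))) = meval v by [].
apply/funext => r; apply: meval_eq => i.
by rewrite valK.
Qed.

(** * Algebraic dependence of forms *)

Lemma dim_dhomog (R : fieldType) n d : \dim {:dhomog n.+1 R d} = 'C(d + n, d).
Proof. by rewrite dimvf. Qed.

(** As functions of e, the left side is a polynomial of degree n and the right
    side one of degree k > n.  The witness makes the comparison elementary, since
    ed + i <= (d + 1)(e + i) gives C(ed+n, n) <= (d+1)^n C(e+n, n). *)
Lemma binomial_outgrows n k d : (n < k)%N ->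
  exists e, ('C(e * d + n, n) < 'C(e + k, k))%N.
Proof.
move=> nk; pose e := (n.+1 * d.+1 ^ n)%N; exists e.
have h1 : ('C(e * d + n, n) <= d.+1 ^ n * 'C(e + n, n))%N.
  rewrite -(leq_pmul2r (fact_gt0 n)) -mulnA !bin_ffact.
  have ffE a : ((a + n) ^_ n = \prod_(i < n) (a + i.+1))%N.
    rewrite ffact_prod (reindex_inj rev_ord_inj); apply: eq_bigr => i _ /=.
    by have := ltn_ord i; lia.
  rewrite !ffE; have -> : (d.+1 ^ n = \prod_(i < n) d.+1)%N.
    by rewrite prod_nat_const card_ord.
  rewrite -big_split /=.
  by apply: leq_prod => i _; nia.
apply: leq_ltn_trans h1 _.
have h2 : ('C(e + n.+1, n.+1) <= 'C(e + k, k))%N.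
  rewrite -(bin_sub (leq_addl e n.+1)) -(bin_sub (leq_addl e k)) !addnK.
  by apply: leq_bin2l; rewrite leq_add2l.
apply: leq_trans h2.
rewrite -(ltn_pmul2l (ltn0Sn n)) addnS -mul_bin_diag mulnA -/e /=.
by rewrite ltn_pmul2r ?bin_gt0 ?leq_addl // ltnS leq_addr.
Qed.

Lemma comp_mpoly_dhomog (R : comNzRingType) n k d e (F : {mpoly R[k]})
    (w : k.-tuple {mpoly R[n]}) :
  (forall i, tnth w i \is d.-homog) -> F \is e.-homog ->
  F \mPo w \is (e * d).-homog.
Proof.
move=> hw hF; rewrite comp_mpolyEX big_seq; apply: rpred_sum => m mF.
apply: dhomogZ; rewrite comp_mpolyX.
have <- : (\sum_i d * m i = e * d)%N.
  by rewrite -big_distrr /= -mdegE (dhomog_mf hF mF) mulnC.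
elim/big_ind2 : _ => [|a p b q|i _]; [exact: dhomog1|exact: dhomogM|].
exact: dhomogMn.
Qed.

(** Substituting [w] maps forms of degree e in k + 1 variables linearly to forms
    of degree ed in n + 1 variables, a space of smaller dimension for suitable
    e. *)
Lemma dhomog_algebraic_dependence (R : fieldType) n k d
    (w : k.+1.-tuple {mpoly R[n.+1]}) : (n < k)%N ->
  (forall i, tnth w i \is d.-homog) ->
  exists e (F : {mpoly R[k.+1]}), [/\ F != 0, F \is e.-homog & F \mPo w = 0].
Proof.
move=> nk hw; have [e he] := binomial_outgrows d nk.
pose comp (F : dhomog k.+1 R e) : dhomog n.+1 R (e * d) :=
  DHomog (comp_mpoly_dhomog hw (dhomog_is_dhomog F)).
have comp_lin : linear comp.
  by move=> a F G; apply: val_inj; rewrite /= linearP.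
pose c : {linear dhomog k.+1 R e -> dhomog n.+1 R (e * d)} :=
  HB.pack comp (GRing.isLinear.Build _ _ _ _ comp comp_lin).
have : lker (linfun c) != 0%VS.
  apply/eqP => ker0; have := limg_ker_dim (linfun c) {:dhomog k.+1 R e}.
  rewrite ker0 capv0 dimv0 add0n => dimE.
  have := dimvS (subvf (limg (linfun c))).
  rewrite dimE !dim_dhomog leqNgt.
  rewrite -(bin_sub (leq_addr k e)) -(bin_sub (leq_addr n (e * d))) !addKn.
  by rewrite he.
rewrite -subv0 => /subvPn[F]; rewrite memv0 memv_ker lfunE => /eqP Fw F0.
exists e, (val F); split; [|exact: dhomog_is_dhomog|].
  by apply: contra F0 => /eqP F0; apply/eqP/val_inj.
by move/(congr1 val): Fw.
Qed.

Lemma meval_dhomog (A : comNzRingType) n e (F : {mpoly A[n]}) k (b : 'I_n -> A)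
    (z : {mpoly A[k]}) : F \is e.-homog ->
  F \mPo [tuple b i *: z | i < n] = F.@[b] *: z ^+ e.
Proof.
move=> hF; rewrite comp_mpolyEX mevalE scaler_suml big_seq [RHS]big_seq.
apply: eq_bigr => m mF; rewrite comp_mpolyX -scalerA; congr (_ *: _).
rewrite -(dhomog_mf hF mF) /= mdegE -prodrXr.
rewrite -scaler_prod; apply: eq_bigr => i _.
by rewrite tnth_mktuple exprZn.
Qed.

Lemma ideal_congr_prod (A : comNzRingType) (I : set A) (J : Type) (r : seq J)
    (x y : J -> A) : is_ideal I -> (forall i, I (x i - y i)) ->
  I (\prod_(i <- r) x i - \prod_(i <- r) y i).
Proof.
move=> II Ixy; have [I0 ID IM] := II.
elim/big_ind2 : _ => [|a b a' b' Iab Iab'|i _]; [by rewrite subrr| |exact: Ixy].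
apply: (@ideal_sub_trans _ _ _ (b * a') _ II).
  by rewrite -mulrBr; exact: IM.
by rewrite -mulrBl; exact: idealMr.
Qed.

Lemma ideal_congr_comp (R : comNzRingType) n k (I : set {mpoly R[n]})
    (F : {mpoly R[k]}) (x y : k.-tuple {mpoly R[n]}) : is_ideal I ->
  (forall i, I (tnth x i - tnth y i)) -> I ((F \mPo x) - (F \mPo y)).
Proof.
move=> II Ixy; rewrite !comp_mpolyEX -sumrB; apply: (ideal_sum _ II) => m _.
rewrite -scalerBr; apply: (idealZ _ II); rewrite !comp_mpolyX.
by apply: ideal_congr_prod => // i; exact: ideal_congrX.
Qed.

(** * Systems of parameters *)

Section SystemOfParameters.
Variables (R : realType) (n d : nat).
Notation P := {mpoly R[n.+1]}.

(** Let F be a homogeneous relation between the generators and [b] a point where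
    F does not vanish and whose first coordinate is nonzero.  Modulo the new
    generators the family [w] is proportional to [b], say w = b z, and the
    relation becomes F(b) z^e = 0. *)
Lemma eliminate_generator k (w : 'I_k.+1 -> P) : (n < k)%N ->
  (forall i, w i \is d.-homog) ->
  exists c : 'I_k -> R,
    forall i, radical (ideal_gen (range (fun j => w (lift ord0 j) - c j *: w ord0))) (w i).
Proof.
move=> nk hw.
have [|e [F [F0 hF Fw]]] := @dhomog_algebraic_dependence R n k d [tuple w i | i < k.+1] nk.
  by move=> i; rewrite tnth_mktuple.
have [b] : exists b, (F * 'X_ord0).@[b] != 0.
  apply: mpoly_nonroot; rewrite mulf_neq0 // -msize_poly_eq0 msizeX.
  by rewrite mdeg1.
rewrite mevalM mevalXU mulf_eq0 negb_or => /andP[Fb b0].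
exists (fun j => b (lift ord0 j) / b ord0).
set J := ideal_gen _; have JJ : is_ideal J := ideal_gen_is_ideal _.
have [_ rD _] := radical_is_ideal JJ.
pose z := (b ord0)^-1 *: w ord0.
have wJ i : J (w i - b i *: z).
  rewrite /z scalerA; have [j ->|->] := unliftP ord0 i.
    by apply: sub_ideal_gen; exists j.
  by rewrite mulfV // scale1r subrr; case: JJ.
have Jz : J (z ^+ e).
  have := @ideal_congr_comp _ _ _ J F [tuple w i | i < k.+1] [tuple b i *: z | i < k.+1] JJ.
  rewrite Fw (meval_dhomog _ _ hF) sub0r => /(_ _)/(idealN JJ).
  rewrite opprK => Jz; rewrite -[z ^+ e]scale1r -(mulVf Fb) -scalerA.
  by apply: (idealZ _ JJ); apply: Jz => i; rewrite !tnth_mktuple.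
have rz : radical J z by exists e.
move=> i; rewrite -(subrK (b i *: z) (w i)); apply: rD.
  exact: sub_radical.
exact: (idealZ _ (radical_is_ideal JJ) rz).
Qed.

(** The radical is kept while generators are eliminated one by one.  The new
    generators are combinations of the old ones and therefore stay in [I]. *)
Lemma few_generators (I : set P) k (w : 'I_k -> P) : is_ideal I ->
    (forall i, w i \is d.-homog /\ I (w i)) ->
    (forall i, radical (ideal_gen (range w)) 'X_i) ->
  exists p : 'I_n.+1 -> P,
    (forall i, p i \is d.-homog /\ I (p i)) /\
    (forall i, radical (ideal_gen (range p)) 'X_i).
Proof.
move=> II; elim: k w => [|k IH] w wP wX.
  exists (fun=> 0); split=> [i|i]; first by rewrite dhomog0; case: II.
  apply: radicalS (wX i); apply: ideal_gen_min; first exact: ideal_gen_is_ideal.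
  by move=> q [[m m0] _ _].
have [kn|nk] := leqP k n.
  (* At most n + 1 generators: the family is completed by zeros. *)
  pose p (i : 'I_n.+1) := oapp w 0 (insub (val i)).
  exists p; split=> [i|i].
    rewrite /p; case: insubP => [j _ _|_] /=; first exact: wP.
    by rewrite dhomog0; case: II.
  apply: radicalS (wX i); apply: ideal_gen_min; first exact: ideal_gen_is_ideal.
  move=> _ [j _ <-]; apply: sub_ideal_gen.
  by exists (widen_ord (kn : (k.+1 <= n.+1)%N) j) => //; rewrite /p valK.
have [|c cP] := eliminate_generator (w := w) nk; first by move=> i; case: (wP i).
apply: (IH (fun j => w (lift ord0 j) - c j *: w ord0)).
  move=> i; have [h0 I0] := wP ord0; have [hi Ii] := wP (lift ord0 i).
  split; first by rewrite rpredB // rpredZ.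
  by apply: idealB => //; exact: (idealZ _ II).
move=> i; apply: radical_radical; apply: radicalS (wX i).
apply: ideal_gen_min; first exact/radical_is_ideal/ideal_gen_is_ideal.
by move=> _ [j _ <-]; exact: cP.
Qed.

(** Membership in the irrelevant ideal only depends on the constant term, which
    makes the ideal visibly radical. *)
Lemma irrelevant_idealP (p : P) :
  ideal_gen (range (fun i : 'I_n.+1 => 'X_i)) p <-> p@_0%MM = 0.
Proof.
set I := ideal_gen _; have II : is_ideal I := ideal_gen_is_ideal _.
split.
  pose T := [set p : P | p@_0%MM = 0]; suff : I `<=` T by move=> /(_ p).
  apply: ideal_gen_min.
    split=> [|x y x0 y0|a x x0]; rewrite /T /=.
    - exact: mcoeff0.
    - by rewrite mcoeffD x0 y0 addr0.
    - by rewrite rmorphM /= x0 mulr0.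
  by move=> _ [i _ <-]; rewrite /T /= mcoeffX mnm1_eq0.
move=> p0; rewrite [p]mpolyE big_seq; apply: (ideal_sum _ II) => m mp.
apply: (idealZ _ II).
have [i mi] : exists i, m i != 0%N.
  apply/existsP; apply: contraTT mp; rewrite negb_exists => /forallP m0.
  have -> : m = 0%MM.
    by apply/mnmP => i; rewrite mnm0E; apply/eqP; have := m0 i; rewrite negbK.
  by rewrite -mcoeff_eq0 p0.
rewrite -(submK (m := U_(i)) (m' := m)) ?lep1mP // mpolyXD.
by case: II => _ _; apply; apply: sub_ideal_gen; exists i.
Qed.

Lemma seq_of_parametersP (p : 'I_n.+1 -> P) : (0 < d)%N ->
  (forall i, p i \is d.-homog) -> (forall i, radical (ideal_gen (range p)) 'X_i) ->
  seq_of_parameters d p.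
Proof.
move=> d0 hp pX; split=> //; apply/seteqP; split=> x; last first.
  apply: ideal_gen_min; first exact/radical_is_ideal/ideal_gen_is_ideal.
  by move=> _ [i _ <-].
move=> [k px]; apply/irrelevant_idealP; apply/eqP.
have : (x ^+ k)@_0%MM = 0.
  apply/irrelevant_idealP; move: px; apply: ideal_gen_min.
    exact: ideal_gen_is_ideal.
  move=> _ [i _ <-]; apply/irrelevant_idealP.
  by apply: dhomog_nemf_coeff (hp i) _; rewrite /= mdeg0 eq_sym -lt0n.
by rewrite rmorphXn /= => /eqP; rewrite expf_eq0 => /andP[].
Qed.

Lemma extremal_apolar_parameters (L : 'Hom(dhomog n.+1 R (2 * d), R^o)) : (0 < d)%N ->
  (forall i, radical (apolar_ideal L) 'X_i) ->
  exists2 p : 'I_n.+1 -> P, seq_of_parameters d p & range p `<=` apolar_ideal L.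
Proof.
move=> d0 LX; have II := apolar_ideal_is_ideal L.
pose w (i : 'I_(\dim (apolar_kernel L))) : P := val (vbasis (apolar_kernel L))`_i.
have [i|i|p [hp pX]] := few_generators (w := w) II.
- split; first exact: dhomog_is_dhomog.
  by apply/apolar_ideal_deg/vbasis_mem/mem_nth; rewrite size_tuple.
- apply: radicalS (LX i); apply: ideal_gen_min; first exact: ideal_gen_is_ideal.
  move=> _ [q qK <-]; rewrite (coord_vbasis qK) raddf_sum.
  have wI := ideal_gen_is_ideal (range w).
  apply: (ideal_sum _ wI) => j _; apply: (idealZ _ wI).
  by apply: sub_ideal_gen; exists j.
exists p; last by move=> _ [i _ <-]; case: (hp i).
by apply: seq_of_parametersP => // i; case: (hp i).
Qed.

End SystemOfParameters.

(** * Leading monomials *)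

Section LeadingMonomials.
Variables (R : realType) (n : nat).
Implicit Types (J : set {mpoly R[n.+1]}) (p q : {mpoly R[n.+1]}) (m : 'X_{1..n.+1}).

Definition leading_monomial J k m : Prop :=
  exists p, [/\ p != 0, p \is k.-homog, J p & mlead p = m].

(** Division by elements of [J], by well-founded induction on the monomial
    order. *)
Lemma leading_monomials_full J k : is_ideal J ->
  (forall m, mdeg m = k -> leading_monomial J k m) ->
  forall q, q \is k.-homog -> J q.
Proof.
move=> JJ leadJ q; have [J0 JD JM] := JJ.
suff /(_ (mlead q) q erefl) : forall m q, mlead q = m -> q \is k.-homog -> J q by [].
move=> {q}; apply: ltmwf => m IH q qm hq.
have [->//|q0] := eqVneq q 0.
have dm : mdeg m = k by rewrite -qm; apply: (dhomog_mf hq); exact: mlead_supp.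
have [p [p0 hp Jp pm]] := leadJ m dm.
(* Cancel the leading term of q by a multiple of p. *)
pose c := q@_m / p@_m; pose r := q - c *: p.
have pm0 : p@_m != 0 by rewrite -pm mleadc_eq0.
have rm : r@_m = 0 by rewrite mcoeffB mcoeffZ /c divfK // subrr.
have hr : r \is k.-homog by rewrite rpredB // rpredZ.
have Jcp : J (c *: p) by exact: idealZ.
rewrite -(subrK (c *: p) q) -/r; apply: (JD) => //.
have [->//|r0] := eqVneq r 0.
apply: (IH (mlead r)) => //; rewrite lt_neqAle; apply/andP; split.
  by apply: contraNneq r0 => rlm; rewrite -mleadc_eq0 rlm rm.
apply: le_trans (mleadB_le _ _) _; rewrite leUx qm lexx /=.
by rewrite -pm; exact: mleadZ_le.
Qed.

Lemma nonleading_divisor J m m' : is_ideal J -> (m' <= m)%MM ->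
  ~ leading_monomial J (mdeg m) m -> ~ leading_monomial J (mdeg m') m'.
Proof.
move=> [_ _ JM] m'm mJ [p [p0 hp Jp pm']]; apply: mJ.
have X0 : ('X_[m - m'] : {mpoly R[n.+1]}) != 0.
  by rewrite -msize_poly_eq0 msizeX.
exists ('X_[m - m'] * p); split.
- exact: mulf_neq0.
- rewrite -(submK m'm) mdegD; apply: dhomogM => //.
  by rewrite submK // dhomogX.
- exact: JM.
- by rewrite mleadM // mleadXm pm' submK.
Qed.

Lemma nonleading_exponent J m d i : is_ideal J -> J ('X_i ^+ d) ->
  ~ leading_monomial J (mdeg m) m -> (m i < d)%N.
Proof.
move=> [_ _ JM] JX mJ; rewrite ltnNge; apply/negP => dm; apply: mJ.
have le : (U_(i) *+ d <= m)%MM.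
  apply/mnm_lepP => j; rewrite mulmnE mnm1E.
  by case: eqP => [<-|_]; rewrite ?mul1n.
exists 'X_[m]; split.
- by rewrite -msize_poly_eq0 msizeX.
- by rewrite dhomogX.
- by rewrite -(submK le) mpolyXD -mpolyXn; exact: JM.
- exact: mleadXm.
Qed.

(** The span of the nonleading monomials meets [J] trivially, since a nonzero
    common element would have one of them as its leading monomial. *)
Lemma dim_graded_part_nonleading J d (D : pred 'X_{1..n.+1 < d.+1}) : is_ideal J ->
  (forall m : 'X_{1..n.+1 < d.+1}, D m -> mdeg m = d /\ ~ leading_monomial J d m) ->
  (#|D| + \dim (graded_part J d) <= 'C(d + n, d))%N.
Proof.
move=> JJ DP; pose e (i : 'I_#|D|) : 'X_{1..n.+1} := enum_val i.
have eP i : mdeg (e i) = d /\ ~ leading_monomial J d (e i).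
  by apply: DP; exact: (enum_valP i).
pose X := [tuple hmon R d (e i) | i < #|D|].
have XE (i : 'I_#|D|) : val X`_i = 'X_[e i].
  by rewrite -tnth_nth tnth_mktuple val_hmon //; case: (eP i).
have coefX (c : 'I_#|D| -> R) i : (val (\sum_j c j *: X`_j))@_(e i) = c i.
  rewrite raddf_sum raddf_sum /= (bigD1 i) //= big1 ?addr0.
    by rewrite mcoeffZ XE mcoeffX eqxx mulr1.
  move=> j ji; rewrite mcoeffZ XE mcoeffX; case: eqP; last by rewrite mulr0.
  by move=> /val_inj/enum_val_inj ij; rewrite ij eqxx in ji.
have freeX : free X.
  by apply/freeP => c c0 i; rewrite -(coefX c) c0 mcoeff0.
have capXJ : (<<X>> :&: graded_part J d = 0)%VS.
  apply/eqP; rewrite -subv0; apply/subvP => p; rewrite memv_cap memv0.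
  move=> /andP[pX /(graded_partP JJ) Jp]; apply/negPn/negP => p0.
  have vp0 : val p != 0 by apply: contra p0 => /eqP vp0; apply/eqP/val_inj.
  have [i lp] : exists i, mlead (val p) = e i.
    apply: contrapT => np; move: vp0; rewrite -mleadc_eq0.
    move: np; set l := mlead _; rewrite (coord_span pX) => np.
    move=> /negP; apply; apply/eqP; rewrite raddf_sum raddf_sum /= big1 // => i _.
    rewrite mcoeffZ XE mcoeffX; case: eqP; last by rewrite mulr0.
    by move=> ei; case: np; exists i.
  by case: (eP i) => _; apply; exists (val p); split=> //; exact: dhomog_is_dhomog.
have := dimvS (subvf (<<X>> + graded_part J d)%VS).
rewrite dim_dhomog dimv_disjoint_sum //.
by move: freeX; rewrite /free size_tuple => /eqP ->.
Qed.

Lemma escaping_monomial J d k : is_ideal J -> (forall i, J ('X_i ^+ d)) ->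
  (exists v : dhomog n.+1 R k, ~ J (val v)) ->
  exists m, [/\ mdeg m = k, forall i, (m i < d)%N
   & (#|[pred m' : 'X_{1..n.+1 < d.+1} | (mdeg m' == d) && (m' <= m)%MM]|
       + \dim (graded_part J d) <= 'C(d + n, d))%N].
Proof.
move=> JJ JX [v Jv].
have [m [dm mJ]] : exists m, mdeg m = k /\ ~ leading_monomial J k m.
  apply: contrapT => nm; apply: Jv; apply: (leading_monomials_full JJ (k := k)).
    by move=> m dm; apply: contrapT => mJ; apply: nm; exists m.
  exact: dhomog_is_dhomog.
rewrite -dm in mJ; exists m; split=> //.
  by move=> i; exact: nonleading_exponent JJ (JX i) mJ.
apply: dim_graded_part_nonleading => // m' /andP[/eqP dm' m'm]; split=> //.
by rewrite -[in X in leading_monomial _ X]dm'; exact: (nonleading_divisor JJ m'm mJ).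
Qed.

End LeadingMonomials.

(** * Counting divisors of a monomial *)

(** The generating polynomial 1 + t + ... + t^a of the exponents from 0 to [a]. *)
Definition poly_range (a : nat) : {poly nat} := \sum_(i < a.+1) 'X^i.

(** Coefficientwise comparison: over the natural numbers the difference has
    nonnegative coefficients automatically, and the relation is compatible with
    products without side conditions. *)
Definition coef_ge (p q : {poly nat}) : Prop := exists t, p = q + t.

Lemma coef_geP p q i : coef_ge p q -> ((q`_i)%R <= (p`_i)%R)%N.
Proof. by move=> [t ->]; rewrite coefD leq_addr. Qed.

Lemma coef_ge_refl p : coef_ge p p.
Proof. by exists 0; rewrite addr0. Qed.

Lemma coef_ge_trans p q r : coef_ge p q -> coef_ge q r -> coef_ge p r.
Proof. by move=> [s ->] [t ->]; exists (t + s); rewrite addrA. Qed.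

Lemma coef_ge_mull r p q : coef_ge p q -> coef_ge (r * p) (r * q).
Proof. by move=> [t ->]; exists (r * t); rewrite mulrDr. Qed.

Lemma poly_range0 : poly_range 0 = 1.
Proof. by rewrite /poly_range big_ord1 expr0. Qed.

Lemma poly_rangeS a : poly_range a.+1 = poly_range a + 'X^(a.+1).
Proof. by rewrite /poly_range big_ord_recr. Qed.

Lemma poly_range_split a b :
  poly_range (a + b).+1 = poly_range a + 'X^(a.+1) * poly_range b.
Proof.
rewrite /poly_range -addSn -addnS big_split_ord /= mulr_sumr; congr (_ + _).
by apply: eq_bigr => i _; rewrite exprD.
Qed.

(** The basic step that makes two exponents more unequal: the difference of both
    sides is t^(b+1) (1 + ... + t^(a-b-1)). *)
Lemma poly_range_exchange a b : (b < a)%N ->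
  coef_ge (poly_range a * poly_range b.+1) (poly_range a.+1 * poly_range b).
Proof.
move=> ba; exists ('X^(b.+1) * poly_range (a - b.+1)).
rewrite !poly_rangeS mulrDr mulrDl -addrA; congr (_ + _).
have -> : poly_range a = poly_range (a - b.+1) + 'X^((a - b.+1).+1) * poly_range b.
  by rewrite -poly_range_split; congr poly_range; lia.
rewrite mulrDl addrC [_ * 'X^_]mulrC mulrAC -exprD.
by have -> : ((a - b.+1).+1 + b.+1 = a.+1)%N by lia.
Qed.

Lemma poly_range_spread a b a' b' : (a + b = a' + b')%N -> (a <= a')%N -> (b <= a')%N ->
  coef_ge (poly_range a * poly_range b) (poly_range a' * poly_range b').
Proof.
wlog ba : a b / (b <= a)%N.
  move=> wl e aa' ba'; have [ba|ab] := leqP b a; first exact: wl.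
  by rewrite mulrC; apply: wl; rewrite ?(ltnW ab) // addnC.
move=> + aa' _.
have [k ->] : exists k, a' = (a + k)%N by exists (a' - a)%N; rewrite subnKC.
elim: k {a' aa'} a b ba => [|k IH] a b ba e.
  have -> : b' = b by lia.
  by rewrite addn0; exact: coef_ge_refl.
case: b ba e => [|b] ba e; first by lia.
apply: coef_ge_trans (poly_range_exchange ba) _.
by rewrite addnS -addSn; apply: IH; lia.
Qed.

(** Among lists of exponents bounded by [D] with a given sum, the one with as
    many [D] as possible and a single remainder is the smallest.  When a new
    exponent [x] meets the current remainder [r], the pair is replaced by
    (x + r, 0), or by (D, x + r - D) when x + r reaches [D]. *)
Lemma poly_range_greedy (D : nat) (s : seq nat) : (0 < D)%N -> all (fun x => x <= D)%N s ->
  coef_ge (\prod_(x <- s) poly_range x)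
    (poly_range D ^+ (sumn s %/ D) * poly_range (sumn s %% D)).
Proof.
move=> D0; elim: s => [_|x s IH /= /andP[xD sD]].
  by rewrite big_nil /= div0n mod0n expr0 mul1r poly_range0; exact: coef_ge_refl.
rewrite big_cons; apply: coef_ge_trans (coef_ge_mull _ (IH sD)) _.
set q := (sumn s %/ D)%N; set r := (sumn s %% D)%N.
have rD : (r < D)%N by rewrite ltn_mod.
have -> : sumn s = (q * D + r)%N by exact: divn_eq.
rewrite mulrCA addnCA.
have [xr|xr] := ltnP (x + r) D.
  rewrite divnMDl // divn_small // addn0 modnMDl modn_small //.
  apply: coef_ge_mull; rewrite -[poly_range (x + r)]mulr1 -poly_range0.
  by apply: poly_range_spread; lia.
have -> : (q * D + (x + r) = q.+1 * D + (x + r - D))%N by lia.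
have xrD : (x + r - D < D)%N by lia.
rewrite divnMDl // divn_small // addn0 modnMDl modn_small // exprSr -mulrA.
by apply: coef_ge_mull; apply: poly_range_spread; lia.
Qed.

(** Expanding the product over all choices of exponents. *)
Lemma card_divisors n d (m : 'X_{1..n}) :
  #|[pred b : 'X_{1..n < d.+1} | (mdeg b == d) && (b <= m)%MM]| =
  (\prod_(i < n) poly_range (m i))`_d.
Proof.
pose K := (mdeg m).+1.
have mK i : (m i < K)%N by rewrite ltnS mdegE (bigD1 i) //= leq_addr.
pose h (f : {ffun 'I_n -> 'I_K}) : 'X_{1..n < d.+1} :=
  insubd (@bm0 n d) [multinom (f i : nat) | i < n].
pose h' (b : 'X_{1..n < d.+1}) : {ffun 'I_n -> 'I_K} := [ffun i => inord (b i)].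
have -> : \prod_(i < n) poly_range (m i) =
    \sum_(f : {ffun 'I_n -> 'I_K} | f \in family (fun i => [pred j : 'I_K | (j <= m i)%N]))
      'X^(\sum_i f i).
  under eq_bigr => i _ do
    rewrite /poly_range (big_ord_widen K (fun j => 'X^j)) //.
  rewrite (eq_bigr (fun i => \sum_(j in [pred j : 'I_K | (j <= m i)%N]) 'X^j)) //.
  rewrite bigA_distr_big_dep; apply: eq_big => // f _.
  by rewrite prodrXr.
rewrite coef_sum -sum1_card (reindex_onto h h'); last first.
  move=> b /andP[_ /mnm_lepP bm]; apply: val_inj.
  have -> : val b = [multinom (h' b i : nat) | i < n].
    by apply/mnmP => i; rewrite mnmE ffunE inordK // (leq_ltn_trans (bm i)).
  rewrite /h val_insubd.
  have -> : [multinom (h' b i : nat) | i < n] = val b.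
    by apply/mnmP => i; rewrite mnmE ffunE inordK // (leq_ltn_trans (bm i)).
  by rewrite (valP b).
rewrite big_mkcond [RHS]big_mkcond /=; apply: eq_bigr => f _.
have df : mdeg [multinom (f i : nat) | i < n] = (\sum_i f i)%N.
  by rewrite mdegE; apply: eq_bigr => i _; rewrite mnmE.
rewrite coefXn; have [fd|fd] := eqVneq d (\sum_i f i)%N.
  have hf : val (h f) = [multinom (f i : nat) | i < n].
    by rewrite val_insubd df fd ltnSn.
  have -> : h' (h f) == f.
    by apply/eqP/ffunP => i; rewrite ffunE hf mnmE inord_val.
  rewrite inE hf df -fd eqxx andbT /=.
  have -> : ([multinom (f i : nat) | i < n] <= m)%MM =
      (f \in family (fun i => [pred j : 'I_K | (j <= m i)%N])).
    apply/mnm_lepP/familyP => fm i; have := fm i; by rewrite mnmE inE.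
  by case: ifP.
(* The exponents f do not sum to d: then h f has another degree, or f exceeds
   the degree bound and h f is the default monomial 1, which is the image of
   the zero function only. *)
rewrite mulr0n if_same; case: ifP => // /andP[/andP[/eqP dh _] /eqP hf].
case/eqP: fd; rewrite -dh; have := val_insubd (@bm0 n d) [multinom (f i : nat) | i < n].
rewrite -/(h f) df; case: ifP => _ vhf; first by rewrite [bmnm _]vhf df.
rewrite [bmnm _]vhf mdeg0 big1 // => i _.
by rewrite -hf ffunE [bmnm _]vhf mnm0E inordK.
Qed.

(** * The minimal number of divisors *)

Lemma prod_poly_range_mndk n d k : (1 < d)%N -> (k <= n * (d - 1))%N ->
  \prod_(i < n) poly_range (mndk n d k i) =
  poly_range d.-1 ^+ (k %/ d.-1) * poly_range (k %% d.-1).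
Proof.
move=> d1 kn; set q := (k %/ d.-1)%N; set r := (k %% d.-1)%N.
have D0 : (0 < d.-1)%N by lia.
have kE : k = (q * d.-1 + r)%N by exact: divn_eq.
have rD : (r < d.-1)%N by rewrite ltn_mod.
have qn : (q <= n)%N.
  by rewrite -(leq_pmul2r D0); apply: leq_trans (leq_addr r _) _; rewrite -kE -subn1.
pose g i := if (i < q)%N then d.-1 else if i == q then r else 0%N.
rewrite (eq_bigr (fun i : 'I_n => poly_range (g i))); last first.
  by move=> i _; rewrite mnmE.
rewrite -(big_mkord xpredT (fun i => poly_range (g i))) (big_cat_nat (leq0n q) qn) /=.
congr (_ * _).
  rewrite (@eq_big_nat _ _ _ _ _ _ (fun=> poly_range d.-1)); last first.
    by move=> i /= iq; rewrite /g iq.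
  by rewrite prodr_const_nat subn0.
have [qn'|nq] := ltnP q n.
  rewrite big_ltn // big_nat big1 ?mulr1; last first.
    by move=> i /andP[qi _]; rewrite /g ltnNge (ltnW qi) /= gtn_eqF // poly_range0.
  by rewrite /g ltnn eqxx.
rewrite big_geq //; have -> : r = 0%N by nia.
by rewrite poly_range0.
Qed.

(** Among all monomials of degree [k] with exponents below [d], the monomial
    [mndk n d k] is the greedy one. *)
Lemma Cndk_min n d k (m : 'X_{1..n}) : (1 < d)%N -> (k <= n * (d - 1))%N ->
  mdeg m = k -> (forall i, m i < d)%N ->
  (Cndk n d k <= #|[pred b : 'X_{1..n < d.+1} | (mdeg b == d) && (b <= m)%MM]|)%N.
Proof.
move=> d1 kn dm md; rewrite /Cndk !card_divisors.
apply: coef_geP; rewrite prod_poly_range_mndk //.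
have D0 : (0 < d.-1)%N by lia.
have [|t ht] := @poly_range_greedy d.-1 [seq m i | i <- enum 'I_n] D0.
  by apply/allP => _ /mapP[i _ ->]; have := md i; lia.
have sE : sumn [seq m i | i <- enum 'I_n] = k.
  by rewrite sumnE big_map big_enum -dm mdegE.
by exists t; rewrite sE big_map big_enum in ht.
Qed.

(** * The length of a decomposition *)

Theorem theorem3p17 (R : realType) (n d : nat) (hd : (2 <= d)%N)
    (hnd : (2 * d <= n.+1 * (d - 1))%N)
    (f : dhomog n.+1 R (2 * d))
    (fsos : sos_cone f) (fpos : strictly_positive f)
    (fbd : boundary (@sos_cone R n.+1 d : set (euclidean (dhomog n.+1 R (2 * d)))) f)
    (egh : EGH R n d)
    (ps : seq (dhomog n.+1 R d))
    (psfree : free ps)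
    (fps : (f : {mpoly R[n.+1]}) = \sum_(p <- ps) (p : {mpoly R[n.+1]}) ^+ 2) :
  (size ps <= Nndk n.+1 d (2 * d) - 1)%N.
Proof.
have d0 : (0 < d)%N by exact: leq_trans hd.
have [L [L0 Lf psdL extL]] := extremal_functional fsos fbd.2.
set I := apolar_ideal L; have II : is_ideal I := apolar_ideal_is_ideal L.
have psK : {subset ps <= apolar_kernel L}.
  apply: squares_in_kernel => //; rewrite -[RHS]Lf; congr (L _).
  by apply: val_inj; rewrite /= fps raddf_sum.
have [||J [[JJ _] JX HFJ]] := egh I (apolar_ideal_homog L).
- exists (apolar_gens L) => // _ [p _ <-]; exact: dhomog_is_dhomog.
- apply: extremal_apolar_parameters => //.
  exact: (extremal_apolar_nilpotent extL d0 L0 Lf fpos).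
(* HF subtracts dimensions of subspaces from that of the ambient space, so the
   truncation of natural subtraction does not occur. *)
have dimJ k : \dim (graded_part J k) = \dim (graded_part I k).
  have := HFJ k; rewrite /HF.
  have := dimvS (subvf (graded_part J k)); have := dimvS (subvf (graded_part I k)).
  by lia.
have [v Jv] : exists v : dhomog n.+1 R (2 * d), ~ J (val v).
  apply: contrapT => nv.
  have Jfull : graded_part J (2 * d) = fullv.
    apply/eqP; rewrite eqEsubv subvf; apply/subvP => v _.
    by apply/(graded_partP JJ); apply: contrapT => Jv; apply: nv; exists v.
  have Ifull : graded_part I (2 * d) = fullv.
    by apply/eqP; rewrite eqEdim subvf -dimJ Jfull leqnn.
  move/eqP: L0; apply; apply/lfunP => v; rewrite lfunE /=.
  by apply: apolar_ideal_deg2; apply/(graded_partP II v); rewrite Ifull memvf.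
have [|m [dm md]] := escaping_monomial JJ JX (k := 2 * d); first by exists v.
have := Cndk_min hd hnd dm md; set D := #|_| => CD; rewrite dimJ => dimI.
have psI : (size ps <= \dim (graded_part I d))%N.
  move: psfree; rewrite /free => /eqP <-; apply: dimvS; apply/span_subvP => p pps.
  by apply/(graded_partP II)/apolar_ideal_deg/psK.
rewrite /Nndk addnK addSn subn1 /=.
have -> : 'C(n + d, d) = 'C(d + n, d) by rewrite addnC.
by lia.
Qed.
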